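(* For $c$-colors graphs, the Max CDP problem can be approximated within ratio $c$ in $O(mn)$ time; that is, there is an $O(mn)$-time algorithm that, given a $c$-colors graph $G$ and nodes $s,t$, outputs a set of internally disjoint uni-color $st$-paths whose cardinality is at least $1/c$ times the maximum possible.
   Context: All graphs are undirected. For a positive integer $c$, a $c$-colors graph is $G=(V,\{E_1,\ldots,E_c\})$, each $E_i$ a set of edges on $V$ of color $i$ (a pair of nodes may be joined by edges of several colors). $n=|V|$ and $m$ is the total number of edges. A path is uni-color if all its edges have the same color. Paths are internally disjoint if they pairwise share no internal node. Max CDP problem: given a color graph $G$ and nodes $s,t$, find the maximum number of internally disjoint uni-color paths from $s$ to $t$ (paths may have different colors). *)

(* Defs.v *)
From mathcomp Require Import all_boot.
Set Implicit Arguments. Unset Strict Implicit. Unset Printing Implicit Defensive.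

(* Nodes are 0..n-1, colors are 0..c-1.  A c-colors graph is given by a *)
(* list E of colored edges (u, v, i): an undirected edge {u,v} of color *)
(* i.  m = size E.                                                      *)

Definition cedge := (nat * nat * nat)%type.

Definition edge_u (e : cedge) := e.1.1.
Definition edge_v (e : cedge) := e.1.2.
Definition edge_col (e : cedge) := e.2.

Definition edge_norm (e : cedge) : cedge :=
  (minn (edge_u e) (edge_v e), maxn (edge_u e) (edge_v e), edge_col e).

Definition valid_instance (n c s t : nat) (E : seq cedge) : bool :=
  [&& 0 < c, s < n, t < n, s != t,
      all (fun e => [&& edge_u e < n, edge_v e < n, edge_col e < c
                       & edge_u e != edge_v e]) E
    & uniq (map edge_norm E)].

Definition adj (E : seq cedge) (i : nat) (u v : nat) : bool :=
  ((u, v, i) \in E) || ((v, u, i) \in E).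

Definition ucpath (E : seq cedge) (s t i : nat) (vs : seq nat) : bool :=
  match vs with
  | x :: rest => [&& x == s, path (adj E i) x rest, last x rest == t & uniq vs]
  | [::] => false
  end.

(* a colored path: (color, node sequence) *)
Definition cpath := (nat * seq nat)%type.

Definition internal (s t : nat) (p : cpath) : seq nat :=
  [seq v <- p.2 | (v != s) && (v != t)].

Definition int_disjoint (s t : nat) (p q : cpath) : bool :=
  ~~ has (fun v => v \in internal s t q) (internal s t p).

Definition cdp_family (c : nat) (E : seq cedge) (s t : nat) (F : seq cpath) : bool :=
  [&& uniq F,
      all (fun p => (p.1 < c) && ucpath E s t p.1 p.2) F
    & pairwise (int_disjoint s t) F].

(* Computational model: unit-cost RAM (registers indexed by nat, holding *)
(* nat), with addition, truncated subtraction, indirect addressing and   *)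
(* conditional jumps.  Running time = number of executed instructions.  *)

Inductive instr : Type :=
| IConst of nat & nat        (* IConst r k  :  R[r] := k              *)
| IAdd of nat & nat & nat    (* IAdd r a b  :  R[r] := R[a] + R[b]    *)
| ISub of nat & nat & nat    (* ISub r a b  :  R[r] := R[a] - R[b]    *)
| ILoad of nat & nat         (* ILoad r a   :  R[r] := R[R[a]]        *)
| IStore of nat & nat        (* IStore a r  :  R[R[a]] := R[r]        *)
| IJz of nat & nat           (* IJz r l     :  if R[r] = 0 goto l     *)
| IJmp of nat                (* IJmp l      :  goto l                 *)
| IHalt.

Definition program := seq instr.
Definition memory := nat -> nat.
Definition state := (nat * memory)%type.   (* (program counter, memory) *)

Definition upd (M : memory) (a x : nat) : memory :=
  fun b => if b == a then x else M b.

Definition fetch (P : program) (pc : nat) : instr := nth IHalt P pc.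

Definition halted (P : program) (st : state) : bool :=
  if fetch P st.1 is IHalt then true else false.

Definition step (P : program) (st : state) : state :=
  let: (pc, M) := st in
  match fetch P pc with
  | IConst r k => (pc.+1, upd M r k)
  | IAdd r a b => (pc.+1, upd M r (M a + M b))
  | ISub r a b => (pc.+1, upd M r (M a - M b))
  | ILoad r a => (pc.+1, upd M r (M (M a)))
  | IStore a r => (pc.+1, upd M (M a) (M r))
  | IJz r l => (if M r == 0 then l else pc.+1, M)
  | IJmp l => (l, M)
  | IHalt => (pc, M)
  end.

Fixpoint exec (P : program) (N : nat) (st : state) : state :=
  if N is N'.+1 then exec P N' (step P st) else st.

(* Input encoding: R[0]=n, R[1]=c, R[2]=s, R[3]=t, R[4]=m, and the k-th
   edge (u,v,i) is stored at R[5+3k], R[6+3k], R[7+3k]; all other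
   registers are 0. *)
Definition input_mem (n c s t : nat) (E : seq cedge) : memory :=
  fun a =>
    if a == 0 then n else if a == 1 then c else if a == 2 then s
    else if a == 3 then t else if a == 4 then size E
    else if (5 <= a) && (a < 5 + 3 * size E) then
      let k := (a - 5) %/ 3 in
      let e := nth (0, 0, 0) E k in
      match (a - 5) %% 3 with
      | 0 => edge_u e | 1 => edge_v e | _ => edge_col e end
    else 0.

Definition init_state (n c s t : nat) (E : seq cedge) : state :=
  (0, input_mem n c s t E).

(* Output encoding: R[0] = address a of the output block; R[a] = number
   k of paths; then, consecutively for each path: its color, its number
   L of nodes, and its L nodes. *)
Fixpoint decode_paths (M : memory) (a k : nat) : seq cpath :=
  if k is k'.+1 then
    let L := M a.+1 in
    (M a, mkseq (fun j => M (a + 2 + j)) L) :: decode_paths M (a + 2 + L) k'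
  else [::].

Definition decode_output (M : memory) : seq cpath :=
  decode_paths M (M 0).+1 (M (M 0)).

(* Main.v *)
Require Import Defs.
From mathcomp Require Import all_boot zify.
Set Implicit Arguments. Unset Strict Implicit. Unset Printing Implicit Defensive.

(** For every colour that occurs, a maximum set of internally disjoint paths of that
    colour is computed by augmentation, and the largest of these sets is returned: a
    feasible family splits into at most [c] single-colour families, hence the ratio.

    The current paths are stored as a map [nx] on the vertices other than [s] and [t],
    with [nx v = v] when [v] is unused and [nx v = t] when [v] is the end of a path; [nx]
    is injective off [t], and it misses exactly the first vertices of the paths.  A search
    from [t] goes from [u] to [nx w] for every [w] equal or adjacent to [u].  When it
    reaches a vertex [u] adjacent to [s], setting [nx w] to [u] along the tree path from
    [t] gives one more path.  When it reaches no such vertex, the vertices equal or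
    adjacent to a reached one, minus the reached ones, separate [s] from [t], and there
    are at most as many of them as there are paths.

    With [k] paths in a colour with [m_i] edges this takes [k + 1] searches costing
    [O(n + m_i)] each, and [k <= n], [k <= 2 m_i]; summing over the colours that occur
    gives [O(mn)] independently of [c]. *)

(** * A structured language and its compilation to RAM code *)

(** Being reached means being allowed to lack a predecessor. If [u] may receive a new predecessor, a
    neighbour [w] can be redirected to [u], which deprives [nx w] of its own; the choice [w = u]
    instead drops [u] from its path. These two moves replace the usual splitting of each vertex into
    an in-copy and an out-copy. The end [t] accepts any number of predecessors, so searches start
    there.

    An edge between [s] and [t] is a path without internal vertex, which no cut can meet; it is kept
    as a separate flag [vDir] and added once, both to the family and to the upper bound.

    The [O(mn)] count is made on a structured program with a clock, and each tick compiles to a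
    bounded number of instructions. Lists are addressed by [col * n + u], a number not bounded in
    terms of [m] and [n], so no array can get a block of fixed length: the arrays are interleaved,
    and each one is unbounded. *)

Inductive exp : Type :=
| EVar of nat
| ECst of nat
| EAdd of exp & exp
| ESub of exp & exp
| EGet of nat & exp.

Inductive cmd : Type :=
| CSet of nat & exp
| CPut of nat & exp & exp
| CSeq of cmd & cmd
| CIf of exp & cmd & cmd
| CWhile of exp & cmd.

Record store := Store { clock : nat; var : nat -> nat; arr : nat -> nat -> nat }.

(** With [eqn] and the [Arguments] directives below, [/=] resolves reads after writes at literal
    numbers, while writes at symbolic indices stay folded for [setvE]. *)
Definition setv (r : nat -> nat) x v : nat -> nat :=
  fun y => if eqn y x then v else r y.

Definition seta (a : nat -> nat -> nat) k i v : nat -> nat -> nat :=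
  fun k' => if eqn k' k then setv (a k') i v else a k'.

Arguments setv r !x v !y /.
Arguments seta a !k i v !k' /.

Lemma setvE r x v y : setv r x v y = if y == x then v else r y.
Proof. by []. Qed.

Lemma setaE a k i v k' : seta a k i v k' = if k' == k then setv (a k') i v else a k'.
Proof. by []. Qed.

Fixpoint eval (e : exp) (r : nat -> nat) (a : nat -> nat -> nat) : nat :=
  match e with
  | EVar x => r x
  | ECst k => k
  | EAdd e1 e2 => eval e1 r a + eval e2 r a
  | ESub e1 e2 => eval e1 r a - eval e2 r a
  | EGet k e1 => a k (eval e1 r a)
  end.

(** The clock ticks once per assignment and once per evaluated test. Expressions are free here;
    [okcmd] bounds the code that one tick stands for. *)
Inductive run : cmd -> store -> store -> Prop :=
| run_set x e z r a :
    run (CSet x e) (Store z r a) (Store z.+1 (setv r x (eval e r a)) a)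
| run_put k e1 e2 z r a :
    run (CPut k e1 e2) (Store z r a)
        (Store z.+1 r (seta a k (eval e1 r a) (eval e2 r a)))
| run_seq c1 c2 S1 S2 S3 : run c1 S1 S2 -> run c2 S2 S3 -> run (CSeq c1 c2) S1 S3
| run_ifT e c1 c2 z r a S : eval e r a <> 0 ->
    run c1 (Store z.+1 r a) S -> run (CIf e c1 c2) (Store z r a) S
| run_ifF e c1 c2 z r a S : eval e r a = 0 ->
    run c2 (Store z.+1 r a) S -> run (CIf e c1 c2) (Store z r a) S
| run_whileT e c z r a S S' : eval e r a <> 0 ->
    run c (Store z.+1 r a) S -> run (CWhile e c) S S' ->
    run (CWhile e c) (Store z r a) S'
| run_whileF e c z r a : eval e r a = 0 ->
    run (CWhile e c) (Store z r a) (Store z.+1 r a).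

Definition wp c (Q : store -> Prop) S := exists2 S', run c S S' & Q S'.

Fixpoint vmods c : seq nat :=
  match c with
  | CSet x _ => [:: x]
  | CPut _ _ _ => [::]
  | CSeq c1 c2 | CIf _ c1 c2 => vmods c1 ++ vmods c2
  | CWhile _ c => vmods c
  end.

Fixpoint amods c : seq nat :=
  match c with
  | CSet _ _ => [::]
  | CPut k _ _ => [:: k]
  | CSeq c1 c2 | CIf _ c1 c2 => amods c1 ++ amods c2
  | CWhile _ c => amods c
  end.

(** The write sets are syntactic, so for literal numbers the side conditions are closed by [isT],
    and loop invariants need not mention what the loop leaves alone. *)
Definition frame c (S S' : store) :=
  (forall x, x \notin vmods c -> var S' x = var S x) /\
  (forall k, k \notin amods c -> arr S' k = arr S k).

Lemma run_frame c S S' : run c S S' -> frame c S S'.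
Proof.
elim=> {c S S'} /=.
- move=> x e z r a; split=> //= y; rewrite inE => nyx.
  by rewrite setvE (negPf nyx).
- move=> k e1 e2 z r a; split=> //= y; rewrite inE => nyk.
  by rewrite setaE (negPf nyk).
- move=> c1 c2 S1 S2 S3 _ [v1 a1] _ [v2 a2]; split=> y /=; rewrite mem_cat negb_or.
    by case/andP=> n1 n2; rewrite v2 ?v1.
  by case/andP=> n1 n2; rewrite a2 ?a1.
- move=> e c1 c2 z r a S _ _ [v1 a1]; split=> y /=; rewrite mem_cat negb_or.
    by case/andP=> n1 n2; rewrite v1.
  by case/andP=> n1 n2; rewrite a1.
- move=> e c1 c2 z r a S _ _ [v1 a1]; split=> y /=; rewrite mem_cat negb_or.
    by case/andP=> n1 n2; rewrite v1.
  by case/andP=> n1 n2; rewrite a1.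
- move=> e c z r a S S' _ _ [v1 a1] _ [v2 a2]; split=> y n1.
    by rewrite v2 ?v1.
  by rewrite a2 ?a1.
- by [].
Qed.

Lemma wp_set (Q : store -> Prop) x e z r a :
  Q (Store z.+1 (setv r x (eval e r a)) a) -> wp (CSet x e) Q (Store z r a).
Proof. by move=> q; eexists; [apply: run_set | exact: q]. Qed.

Lemma wp_put (Q : store -> Prop) k e1 e2 z r a :
  Q (Store z.+1 r (seta a k (eval e1 r a) (eval e2 r a))) ->
  wp (CPut k e1 e2) Q (Store z r a).
Proof. by move=> q; eexists; [apply: run_put | exact: q]. Qed.

Lemma wp_seq Q c1 c2 S : wp c1 (wp c2 Q) S -> wp (CSeq c1 c2) Q S.
Proof. by case=> S1 r1 [S2 r2 q]; exists S2 => //; apply: run_seq r1 r2. Qed.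

Lemma wp_if Q e c1 c2 z r a :
  (eval e r a <> 0 -> wp c1 Q (Store z.+1 r a)) ->
  (eval e r a = 0 -> wp c2 Q (Store z.+1 r a)) ->
  wp (CIf e c1 c2) Q (Store z r a).
Proof.
move=> wT wF; case: (eval e r a =P 0) => [e0 | en0].
  by have [S' rS q] := wF e0; exists S' => //; apply: run_ifF.
by have [S' rS q] := wT en0; exists S' => //; apply: run_ifT.
Qed.

Lemma wp_conseq (Q Q' : store -> Prop) c S :
  wp c Q' S -> (forall S', frame c S S' -> Q' S' -> Q S') -> wp c Q S.
Proof. by case=> S' rS q imp; exists S' => //; apply: imp => //; apply: run_frame. Qed.

Lemma frame_refl c S : frame c S S.
Proof. by split. Qed.

Lemma frame_trans c S1 S2 S3 : frame c S1 S2 -> frame c S2 S3 -> frame c S1 S3.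
Proof. by case=> v1 a1 [v2 a2]; split=> y ny; rewrite ?v2 ?a2 ?v1 ?a1. Qed.

(** The index of the invariant is the variant, so termination is part of the rule; each iteration
    also receives the frame relative to [S0]. *)
Lemma wp_while (I : nat -> store -> Prop) k0 (Q : store -> Prop) e c S0 :
  I k0 S0 ->
  (forall k z r a, frame c S0 (Store z r a) -> I k (Store z r a) -> eval e r a <> 0 ->
     wp c (fun S' => exists2 k', k' < k & I k' S') (Store z.+1 r a)) ->
  (forall k z r a, frame c S0 (Store z r a) -> I k (Store z r a) -> eval e r a = 0 ->
     Q (Store z.+1 r a)) ->
  wp (CWhile e c) Q S0.
Proof.
move=> I0 body fin.
suff loop k S : I k S -> frame c S0 S -> wp (CWhile e c) Q S.
  by apply: loop I0 (frame_refl c S0).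
elim/ltn_ind: k S => k IHk [z r a] IS fS.
case: (eval e r a =P 0) => [e0 | en0].
  by exists (Store z.+1 r a); [apply: run_whileF | apply: fin IS e0].
have [S1 run1 [k' ltk I1]] := body k z r a fS IS en0.
have [|S2 run2 q] := IHk k' ltk S1 I1.
  apply: frame_trans fS _; have [v1 a1] := run_frame run1.
  by split=> y ny; rewrite ?v1 ?a1.
by exists S2 => //; apply: run_whileT run2.
Qed.

(* Compiled code keeps variable [x < nvars] in register [x], uses registers
   [nvars .. nregs - 1] as an evaluation stack, and stores entry [i] of array [k]
   at address [B + 16 * i + k], with [B] kept in register 1. *)
Definition nvars := 30.
Definition nregs := 40.

(** The machine cannot multiply: four doublings produce the stride 16. *)
Definition caddr d k : seq instr :=
  [:: IAdd d d d; IAdd d d d; IAdd d d d; IAdd d d d;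
      IConst d.+1 k; IAdd d d d.+1; IAdd d d 1].

Arguments caddr : simpl never.

Fixpoint cexp (e : exp) (d : nat) : seq instr :=
  match e with
  | EVar x => [:: IConst d.+1 0; IAdd d x d.+1]
  | ECst k => [:: IConst d k]
  | EAdd e1 e2 => cexp e1 d ++ cexp e2 d.+1 ++ [:: IAdd d d d.+1]
  | ESub e1 e2 => cexp e1 d ++ cexp e2 d.+1 ++ [:: ISub d d d.+1]
  | EGet k e1 => cexp e1 d ++ caddr d k ++ [:: ILoad d d]
  end.

Fixpoint compile (c : cmd) (pc : nat) : seq instr :=
  match c with
  | CSet x e => cexp e nvars ++ [:: IConst nvars.+1 0; IAdd x nvars nvars.+1]
  | CPut k e1 e2 =>
      cexp e1 nvars ++ caddr nvars k ++ cexp e2 nvars.+1 ++ [:: IStore nvars nvars.+1]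
  | CSeq c1 c2 => let p1 := compile c1 pc in p1 ++ compile c2 (pc + size p1)
  | CIf e c1 c2 =>
      let pe := cexp e nvars in
      let p1 := compile c1 (pc + size pe).+1 in
      let p2 := compile c2 (pc + size pe + size p1).+2 in
      pe ++ IJz nvars (pc + size pe + size p1).+2 ::
      p1 ++ IJmp (pc + size pe + size p1 + size p2).+2 :: p2
  | CWhile e c1 =>
      let pe := cexp e nvars in
      let p1 := compile c1 (pc + size pe).+1 in
      pe ++ IJz nvars (pc + size pe + size p1).+2 :: p1 ++ [:: IJmp pc]
  end.

Fixpoint depth (e : exp) : nat :=
  match e with
  | EVar _ => 1
  | ECst _ => 0
  | EAdd e1 e2 | ESub e1 e2 => maxn (depth e1) (depth e2).+1
  | EGet _ e1 => maxn (depth e1) 1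
  end.

Definition okvar x := (x < nvars) && (x != 1).

Fixpoint okexp (e : exp) : bool :=
  match e with
  | EVar x => okvar x
  | ECst _ => true
  | EAdd e1 e2 | ESub e1 e2 => okexp e1 && okexp e2
  | EGet k e1 => (k < 16) && okexp e1
  end.

(** The bound 9 is the room left when evaluation starts at [nvars.+1], as for the second operand of
    [CPut]: 31 + 8 < 40. *)
Definition fits (e : exp) := okexp e && (depth e < 9).

(** [L] bounds the instructions charged to one tick. Beyond the expressions, 2 pays for a register
    copy or for two jumps, and 8 for a 7-instruction address computation and a store. *)
Fixpoint okcmd (L : nat) (c : cmd) : bool :=
  match c with
  | CSet x e => [&& okvar x, fits e & size (cexp e nvars) + 2 <= L]
  | CPut k e1 e2 => [&& k < 16, fits e1, fits e2 &
      size (cexp e1 nvars) + size (cexp e2 nvars.+1) + 8 <= L]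
  | CSeq c1 c2 => okcmd L c1 && okcmd L c2
  | CIf e c1 c2 => [&& fits e, size (cexp e nvars) + 2 <= L, okcmd L c1 & okcmd L c2]
  | CWhile e c1 => [&& fits e, size (cexp e nvars) + 2 <= L & okcmd L c1]
  end.

Arguments fetch : simpl never.

Fixpoint code_at (P : program) pc (code : seq instr) : Prop :=
  if code is i :: code' then fetch P pc = i /\ code_at P pc.+1 code' else True.

Lemma code_at_cat P pc c1 c2 :
  code_at P pc (c1 ++ c2) <-> code_at P pc c1 /\ code_at P (pc + size c1) c2.
Proof.
elim: c1 pc => [|i c1 IH] pc /=; first by rewrite addn0; tauto.
by rewrite IH addSnnS; tauto.
Qed.

Lemma code_at_mid p1 p2 p3 : code_at (p1 ++ p2 ++ p3) (size p1) p2.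
Proof.
elim: p2 p1 => [//|i p2 IH] p1 /=; split.
  by rewrite /fetch nth_cat ltnn subnn.
by have := IH (rcons p1 i); rewrite size_rcons cat_rcons.
Qed.

Definition istep (i : instr) pc (M : memory) : state :=
  match i with
  | IConst r k => (pc.+1, upd M r k)
  | IAdd r a b => (pc.+1, upd M r (M a + M b))
  | ISub r a b => (pc.+1, upd M r (M a - M b))
  | ILoad r a => (pc.+1, upd M r (M (M a)))
  | IStore a r => (pc.+1, upd M (M a) (M r))
  | IJz r l => (if M r == 0 then l else pc.+1, M)
  | IJmp l => (l, M)
  | IHalt => (pc, M)
  end.

Lemma exec_step P N pc M i :
  fetch P pc = i -> exec P N.+1 (pc, M) = exec P N (istep i pc M).
Proof. by rewrite /= => ->. Qed.

Lemma exec0 P S : exec P 0 S = S.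
Proof. by []. Qed.

Lemma exec_add P N1 N2 S : exec P (N1 + N2) S = exec P N2 (exec P N1 S).
Proof. by elim: N1 S => //= N1 IH S; rewrite IH. Qed.

Lemma updE M a x b : upd M a x b = if b == a then x else M b.
Proof. by []. Qed.

Arguments exec : simpl never.

(** * Simulation of structured commands by machine code, with cost *)

Section CompilerCorrectness.
Variables (P : program) (B : nat).
Hypothesis leB : nregs <= B.

Definition reaches N (S S' : state) := exec P N S = S'.

Lemma reaches_trans N1 N2 S1 S2 S3 :
  reaches N1 S1 S2 -> reaches N2 S2 S3 -> reaches (N1 + N2) S1 S3.
Proof. by rewrite /reaches exec_add => -> . Qed.

Definition represents (M : memory) r (a : nat -> nat -> nat) :=
  [/\ M 1 = B, forall x, okvar x -> M x = r x &
      forall k i, k < 16 -> M (B + 16 * i + k) = a k i].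

Definition agree d (M M' : memory) := forall y, (y < d) || (nregs <= y) -> M' y = M y.

Lemma agree_represents d M M' r a : nvars <= d ->
  agree d M M' -> represents M r a -> represents M' r a.
Proof.
move=> led g [h1 h2 h3]; split.
- by rewrite g // (leq_trans _ led).
- by move=> x ok; rewrite g ?h2 // (leq_trans _ led) //; case/andP: ok.
- by move=> k i lk; rewrite g ?h3 //; apply/orP; right; lia.
Qed.

Lemma caddr_ok d k M pc :
  1 < d -> d.+1 < nregs -> M 1 = B -> code_at P pc (caddr d k) ->
  exists M', [/\ reaches 7 (pc, M) (pc + 7, M'), M' d = B + 16 * M d + k &
                 agree d M M'].
Proof.
move=> d0 dn M1 [f0 [f1 [f2 [f3 [f4 [f5 [f6 _]]]]]]].
eexists; split.
    rewrite /reaches (exec_step _ _ f0) /= (exec_step _ _ f1) /= (exec_step _ _ f2) /=.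
    rewrite (exec_step _ _ f3) /= (exec_step _ _ f4) /= (exec_step _ _ f5) /=.
    by rewrite (exec_step _ _ f6) /= exec0 !addnS addn0.
  rewrite /= !updE !eqxx; do ?[case: eqP => ?]; lia.
move=> y hy; rewrite /= !updE; do ?[case: eqP => ?]; lia.
Qed.

Lemma cexp_ok e d M r a pc :
  okexp e -> nvars <= d -> d + depth e < nregs ->
  represents M r a -> code_at P pc (cexp e d) ->
  exists M', [/\ reaches (size (cexp e d)) (pc, M) (pc + size (cexp e d), M'),
                 M' d = eval e r a & agree d M M'].
Proof.
elim: e d M pc => [x|k|e1 IH1 e2 IH2|e1 IH1 e2 IH2|k e1 IH1] d M pc.
- rewrite /= => ok led ltd [h1 h2 h3] [f0 [f1 _]].
  eexists; split.
    by rewrite /reaches (exec_step _ _ f0) /= (exec_step _ _ f1) /= exec0 !addnS addn0.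
    rewrite /= !updE !eqxx -h2 //; case/andP: ok => ? ?; case: eqP => ?; lia.
  by move=> y hy; rewrite /= !updE; do ?[case: eqP => ?]; lia.
- rewrite /= => _ led ltd _ [f0 _].
  eexists; split; first by rewrite /reaches (exec_step _ _ f0) /= exec0 !addnS addn0.
    by rewrite /= !updE eqxx.
  by move=> y hy; rewrite /= !updE; do ?[case: eqP => ?]; lia.
- rewrite /= => /andP[ok1 ok2] led ltd hM; rewrite !code_at_cat => -[c1 [c2 [f _]]].
  have [|M1 [r1 v1 g1]] := IH1 d M pc ok1 led _ hM c1; first lia.
  have [|| M2 [r2 v2 g2]] := IH2 d.+1 M1 _ ok2 _ _ (agree_represents led g1 hM) c2; try lia.
  eexists; split.
  + rewrite !size_cat; apply: reaches_trans r1 _; apply: reaches_trans r2 _.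
    by rewrite /reaches (exec_step _ _ f) /= exec0 !addnA addn1.
  + by rewrite /= updE eqxx g2 ?ltnSn // v1 v2.
  + move=> y hy; rewrite /= updE; case: eqP => ?; first lia.
    by rewrite g2 ?g1 //; lia.
- rewrite /= => /andP[ok1 ok2] led ltd hM; rewrite !code_at_cat => -[c1 [c2 [f _]]].
  have [|M1 [r1 v1 g1]] := IH1 d M pc ok1 led _ hM c1; first lia.
  have [|| M2 [r2 v2 g2]] := IH2 d.+1 M1 _ ok2 _ _ (agree_represents led g1 hM) c2; try lia.
  eexists; split.
  + rewrite !size_cat; apply: reaches_trans r1 _; apply: reaches_trans r2 _.
    by rewrite /reaches (exec_step _ _ f) /= exec0 !addnA addn1.
  + by rewrite /= updE eqxx g2 ?ltnSn // v1 v2.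
  + move=> y hy; rewrite /= updE; case: eqP => ?; first lia.
    by rewrite g2 ?g1 //; lia.
- case/andP=> ltk ok1 led; rewrite [depth _]/= => ltd hM.
  have -> : cexp (EGet k e1) d = cexp e1 d ++ caddr d k ++ [:: ILoad d d] by [].
  rewrite !code_at_cat => -[c1 [c2 [f _]]].
  have [|M1 [r1 v1 g1]] := IH1 d M pc ok1 led _ hM c1; first lia.
  have hM1 := agree_represents led g1 hM.
  have [|||M2 [r2 v2 g2]] := @caddr_ok d k M1 _ _ _ _ c2.
  + by rewrite (leq_trans _ led).
  + lia.
  + by case: hM1.
  have [h1 h2 h3] := agree_represents led g2 hM1.
  eexists; split.
  + rewrite !size_cat; apply: reaches_trans r1 _; apply: reaches_trans r2 _.
    by rewrite /reaches (exec_step _ _ f) /= exec0 !addnA addn1.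
  + by rewrite /= updE eqxx v2 h3 // v1.
  + move=> y hy; rewrite /= updE; case: eqP => ?; first lia.
    by rewrite g2 ?g1 //; lia.
Qed.

(** The last inequality says, without subtraction, that at most [L] instructions are executed per
    tick; in this form it adds up along sequences and loops. *)
Lemma compile_ok L c S S' : run c S S' -> okcmd L c -> forall M pc,
  represents M (var S) (arr S) -> code_at P pc (compile c pc) ->
  exists M' N, [/\ reaches N (pc, M) (pc + size (compile c pc), M'),
    represents M' (var S') (arr S') & N + L * clock S <= L * clock S'].
Proof.
have nvE : nvars = 30 by [].
have nrE : nregs = 40 by [].
elim=> {c S S'}.
- rewrite /= => x e z r a /and3P[okx /andP[oke de] leL] M pc hM.
  rewrite code_at_cat => -[c1 [f1 [f2 _]]].
  have [|M1 [r1 v1 g1]] := cexp_ok oke (leqnn _) _ hM c1; first by lia.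
  have [h1 h2 h3] := agree_represents (leqnn _) g1 hM.
  eexists _, (size (cexp e nvars) + 2); split.
  + rewrite size_cat; apply: reaches_trans r1 _.
    by rewrite /reaches (exec_step _ _ f1) /= (exec_step _ _ f2) /= exec0 !addnA addn2.
  + have [ltx nx1] := andP okx.
    split=> [|y oky|k i ltk]; rewrite /= ?setvE !updE.
    * by rewrite eq_sym (negPf nx1).
    * case: eqP => _; first by rewrite /= addn0.
      rewrite -h2 //; case/andP: oky => lty _.
      by do ?[case: eqP => // ?]; lia.
    * have ?: nregs <= B + 16 * i + k by lia.
      by rewrite -h3 //; do ![case: eqP => // ?]; lia.
  + lia.
- move=> k e1 e2 z r a /and4P[ltk /andP[ok1 d1] /andP[ok2 d2] leL] M pc.
  rewrite /arr /var /clock => hM.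
  have -> : compile (CPut k e1 e2) pc = cexp e1 nvars ++ caddr nvars k ++
    cexp e2 nvars.+1 ++ [:: IStore nvars nvars.+1] by [].
  rewrite !code_at_cat => -[c1 [c2 [c3 [f _]]]].
  have [|M1 [r1 v1 g1]] := cexp_ok ok1 (leqnn _) _ hM c1; first by lia.
  have hM1 := agree_represents (leqnn _) g1 hM.
  have [|||M2 [r2 v2 g2]] := @caddr_ok nvars k M1 _ _ _ _ c2 => //; first by case: hM1.
  have hM2 := agree_represents (leqnn _) g2 hM1.
  have [||M3 [r3 v3 g3]] := @cexp_ok e2 nvars.+1 M2 r a _ ok2 _ _ hM2 c3; try lia.
  have [h1 h2 h3] := agree_represents (leqnSn _) g3 hM2.
  have v30 : M3 nvars = B + 16 * eval e1 r a + k by rewrite g3 ?ltnSn // v2 v1.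
  eexists _, (size (cexp e1 nvars) + (7 + (size (cexp e2 nvars.+1) + 1))); split.
  + rewrite !size_cat; apply: reaches_trans r1 _; apply: reaches_trans r2 _.
    apply: reaches_trans r3 _.
    by rewrite /reaches (exec_step _ _ f) /= exec0 !addnA addn1.
  + have ltn : nregs <= M3 nvars by rewrite v30; lia.
    split=> [|y oky|k' i ltk']; rewrite /= !updE.
    * by case: eqP => [y1|_ //]; lia.
    * case: eqP => [y1|_]; last exact: h2.
      by case/andP: oky; lia.
    * rewrite v30 v3 h3 // setaE.
      case: eqP => [eqa|nea]; case: eqP => [eqk|nek] //.
      - by rewrite setvE; case: eqP => // ?; lia.
      - by lia.
      - by rewrite setvE; case: eqP => // ?; case: nea; lia.
  + lia.
- rewrite /= => c1 c2 S1 S2 S3 _ IH1 _ IH2 /andP[ok1 ok2] M pc hM.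
  rewrite code_at_cat => -[k1 k2].
  have [M1 [N1 [r1 h1 t1]]] := IH1 ok1 _ _ hM k1.
  have [M2 [N2 [r2 h2 t2]]] := IH2 ok2 _ _ h1 k2.
  exists M2, (N1 + N2); split=> //; last lia.
  by rewrite size_cat addnA; apply: reaches_trans r1 r2.
- rewrite /= => e c1 c2 z r a S en0 _ IH1 /and4P[/andP[oke de] leL ok1 ok2] M pc hM.
  rewrite code_at_cat /= code_at_cat /= => -[ke [fj [k1 [fm k2]]]].
  have [|M1 [r1 v1 g1]] := cexp_ok oke (leqnn _) _ hM ke; first by lia.
  have hM1 := agree_represents (leqnn _) g1 hM.
  have [M2 [N2 [r2 h2 t2]]] := IH1 ok1 _ _ hM1 k1.
  exists M2, (size (cexp e nvars) + (1 + (N2 + 1))); split=> //; last by move: t2 => /=; lia.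
  apply: reaches_trans r1 _; apply: reaches_trans.
    by rewrite /reaches (exec_step _ _ fj) /= exec0 v1 (introF eqP en0).
  apply: reaches_trans r2 _.
  by rewrite /reaches (exec_step _ _ fm) /= exec0 !size_cat /= size_cat /=; congr pair; lia.
- rewrite /= => e c1 c2 z r a S en0 _ IH1 /and4P[/andP[oke de] leL ok1 ok2] M pc hM.
  rewrite code_at_cat /= code_at_cat /= => -[ke [fj [k1 [fm k2]]]].
  have [|M1 [r1 v1 g1]] := cexp_ok oke (leqnn _) _ hM ke; first by lia.
  have hM1 := agree_represents (leqnn _) g1 hM.
  have e2 : ((pc + size (cexp e nvars)).+1 + size (compile c1 (pc + size (cexp e nvars)).+1)).+1
     = (pc + size (cexp e nvars) + size (compile c1 (pc + size (cexp e nvars)).+1)).+2 by lia.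
  rewrite e2 in k2.
  have [M2 [N2 [r2 h2 t2]]] := IH1 ok2 _ _ hM1 k2.
  exists M2, (size (cexp e nvars) + (1 + N2)); split=> //; last by move: t2 => /=; lia.
  apply: reaches_trans r1 _; apply: reaches_trans.
    by rewrite /reaches (exec_step _ _ fj) /= exec0 v1 en0 eqxx.
  move: r2; set X := (X in reaches _ _ X -> _); set Y := (X in _ -> reaches _ _ X).
  suff -> : X = Y by [].
  by rewrite /X /Y !size_cat /= size_cat /=; congr pair; lia.
- rewrite /= => e c z r a S S' en0 _ IH1 _ IH2 ok M pc hM.
  have := ok => /and3P[/andP[oke de] leL ok1] ko.
  have := ko; rewrite code_at_cat /= code_at_cat /= => -[ke [fj [k1 [fm _]]]].
  have [|M1 [r1 v1 g1]] := cexp_ok oke (leqnn _) _ hM ke; first by lia.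
  have hM1 := agree_represents (leqnn _) g1 hM.
  have [M2 [N2 [r2 h2 t2]]] := IH1 ok1 _ _ hM1 k1.
  have [M3 [N3 [r3 h3 t3]]] := IH2 ok _ _ h2 ko.
  exists M3, (size (cexp e nvars) + (1 + (N2 + (1 + N3)))); split=> //.
    apply: reaches_trans r1 _; apply: reaches_trans.
      by rewrite /reaches (exec_step _ _ fj) /= exec0 v1 (introF eqP en0).
    apply: reaches_trans r2 _; apply: reaches_trans r3.
    by rewrite /reaches (exec_step _ _ fm) /= exec0.
  by move: t2 t3 => /=; lia.
- rewrite /= => e c z r a e0 /and3P[/andP[oke de] leL ok1] M pc hM.
  rewrite code_at_cat /= code_at_cat /= => -[ke [fj [k1 [fm _]]]].
  have [|M1 [r1 v1 g1]] := cexp_ok oke (leqnn _) _ hM ke; first by lia.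
  exists M1, (size (cexp e nvars) + 1); split=> //; last lia.
    apply: reaches_trans r1 _.
    rewrite /reaches (exec_step _ _ fj) /= exec0 v1 e0 eqxx !size_cat /= size_cat /=.
    congr pair; lia.
  exact: agree_represents g1 hM.
Qed.

End CompilerCorrectness.

(** * Loading the input and emitting the output *)

(** Registers 8 and 9 are the source and destination pointers, 12 is the transfer cell, and 10 and
    11 hold the strides 1 and 16; register 10 also serves as the decrement. *)
Definition copy_loop pc ss ds cnt : seq instr :=
  [:: IJz cnt (pc + 7); ILoad 12 8; IStore 9 12; IAdd 8 8 ss; IAdd 9 9 ds;
      ISub cnt cnt 10; IJmp pc].

(** The two blocks may overlap provided that no cell is overwritten before it is read, hence a
    condition on [i < j] only. They do overlap in [emit]. *)
Lemma copy_loop_ok P pc ss ds cnt :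
  code_at P pc (copy_loop pc ss ds cnt) ->
  ss \in [:: 10; 11] -> ds \in [:: 10; 11] -> cnt \notin [:: 8; 9; 10; 11; 12] ->
  cnt < nregs ->
  forall k M src dst, M cnt = k -> M 8 = src -> M 9 = dst -> M 10 = 1 -> 0 < M ds ->
  nregs <= src -> nregs <= dst ->
  (forall i j, i < j -> j < k -> dst + i * M ds <> src + j * M ss) ->
  exists M', [/\ reaches P (7 * k + 1) (pc, M) (pc + 7, M'),
    forall i, i < k -> M' (dst + i * M ds) = M (src + i * M ss) &
    forall y, y \notin [:: 8; 9; 12; cnt] -> (forall i, i < k -> y <> dst + i * M ds) ->
      M' y = M y].
Proof.
have nrE : nregs = 40 by [].
move=> /= [f0 [f1 [f2 [f3 [f4 [f5 [f6 _]]]]]]] ssP dsP cntP cntn.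
elim=> [|k IH] M src dst Mc M8 M9 M10 ds0 lsrc ldst noc.
  exists M; split=> //.
  by rewrite /reaches muln0 add0n (exec_step _ _ f0) /= exec0 Mc eqxx.
have [nc8 nc9 nc10 nc11 nc12] : [/\ cnt <> 8, cnt <> 9, cnt <> 10, cnt <> 11 & cnt <> 12].
  by move: cntP; rewrite !inE; split=> ce; rewrite ce in cntP.
have ssE : ss = 10 \/ ss = 11 by move: ssP; rewrite !inE => /orP[] /eqP; auto.
have dsE : ds = 10 \/ ds = 11 by move: dsP; rewrite !inE => /orP[] /eqP; auto.
have [M5 [stp M5E]] : exists M5, reaches P 7 (pc, M) (pc, M5) /\
    forall y, M5 y = if y == cnt then k else if y == 9 then dst + M ds else
      if y == 8 then src + M ss else if y == dst then M src else
      if y == 12 then M src else M y.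
  eexists; split.
    rewrite /reaches (exec_step _ _ f0) /= Mc /= (exec_step _ _ f1) /= (exec_step _ _ f2) /=.
    rewrite (exec_step _ _ f3) /= (exec_step _ _ f4) /= (exec_step _ _ f5) /=.
    by rewrite (exec_step _ _ f6) /= exec0.
  have dstn x : x < nregs -> (x == dst) = false by lia.
  have c10 : (10 == cnt) = false by lia.
  have c9 : (cnt == 9) = false by lia.
  have c8 : (cnt == 8) = false by lia.
  have c12 : (cnt == 12) = false by lia.
  move=> y; case: ssE dsE => -> [] ->;
    by rewrite !updE /= ?M8 ?M9 ?(dstn 8) ?(dstn 9) ?(dstn 10) ?(dstn 11) ?(dstn cnt) //=
      ?c9 ?c8 ?c12 ?M10 ?Mc ?subn1.
have low y : y <> cnt -> y <> 9 -> y <> 8 -> y <> 12 -> y < nregs -> M5 y = M y.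
  by move=> *; rewrite M5E; do ![case: eqP => ?]; lia.
have M5ss : M5 ss = M ss by apply: low; lia.
have M5ds : M5 ds = M ds by apply: low; lia.
have [||||||||M' [rM' vM' oM']] := IH M5 (src + M ss) (dst + M ds).
- by rewrite M5E eqxx.
- by rewrite M5E; do ![case: eqP => ?]; lia.
- by rewrite M5E; do ![case: eqP => ?]; lia.
- by rewrite low //; lia.
- by rewrite M5ds.
- lia.
- lia.
- move=> i j ltij ltjk; rewrite M5ss M5ds => e.
  by apply: (noc i.+1 j.+1) => //; rewrite !mulSn !addnA.
exists M'; split.
- have -> : 7 * k.+1 + 1 = 7 + (7 * k + 1) by lia.
  exact: reaches_trans stp rM'.
- move=> [_|i lti].
    rewrite !mul0n !addn0 oM' ?M5ds; first by rewrite M5E; do ![case: eqP => ?]; lia.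
      by rewrite !inE; lia.
    by move=> i _; nia.
  have := vM' i; rewrite M5ss M5ds ltnS in lti * => /(_ lti).
  rewrite !mulSn !addnA => ->.
  rewrite M5E; do ![case: eqP => ?]; try lia.
  by case: (noc 0 i.+1) => //; rewrite mul0n addn0 mulSn addnA.
- move=> y yn ny; rewrite oM' //; last first.
    by move=> i lti; have := ny i.+1; rewrite M5ds mulSn addnA; apply.
  have := ny 0; rewrite mul0n addn0 M5E => /(_ isT) nyd.
  by move: yn; rewrite !inE; do ![case: eqP => ?]; lia.
Qed.

(** Register 1 is a moving destination pointer. Register 5 is free for the constant 16 because its
    own content is the first one stored. *)
Definition save_cells k : seq instr :=
  flatten (mkseq (fun j => [:: IStore 1 (5 + j); IConst 5 16; IAdd 1 1 5]) k).

Lemma save_cellsS k :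
  save_cells k.+1 = save_cells k ++ [:: IStore 1 (5 + k); IConst 5 16; IAdd 1 1 5].
Proof. by rewrite /save_cells mkseqS flatten_rcons. Qed.

Lemma size_save_cells k : size (save_cells k) = 3 * k.
Proof. by elim: k => // k IH; rewrite save_cellsS size_cat IH /=; lia. Qed.

Lemma save_cells_ok P pc B M k :
  code_at P pc (save_cells k) -> k <= nregs -> nregs + 5 <= B -> M 1 = B ->
  exists M', [/\ reaches P (3 * k) (pc, M) (pc + 3 * k, M'), M' 1 = B + 16 * k,
    forall i, i < k -> M' (B + 16 * i) = M (5 + i) &
    forall y, y <> 1 -> y <> 5 \/ k = 0 -> (forall i, i < k -> y <> B + 16 * i) ->
      M' y = M y].
Proof.
have nrE : nregs = 40 by [].
move=> + + leB M1; elim: k => [|k IH].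
  by move=> _ _; exists M; split=> //; [rewrite addn0 | rewrite addn0].
rewrite save_cellsS code_at_cat size_save_cells => -[c1 [f0 [f1 [f2 _]]]] lek.
have [|M' [rM' M'1 vM' oM']] := IH c1; first lia.
have M'k : M' (5 + k) = M (5 + k).
  by apply: oM'; [lia | lia | move=> i _; lia].
eexists; split.
- have -> : 3 * k.+1 = 3 * k + 3 by lia.
  apply: reaches_trans rM' _.
  rewrite /reaches (exec_step _ _ f0) /= (exec_step _ _ f1) /= (exec_step _ _ f2) /= exec0.
  by rewrite addnA addn3.
- by rewrite !updE /= M'1; case: eqP => ?; lia.
- move=> i lti; rewrite !updE M'1 M'k; do ![case: eqP => ?]; try lia.
    by congr M; lia.
  by apply: vM'; lia.
- move=> y y1 y5 ny; rewrite !updE M'1.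
  have yk := ny k (ltnSn k).
  do ![case: eqP => ?]; try lia.
  by apply: oM' => //; [left | move=> i lti; apply: ny; lia].
Qed.

(* The input occupies all low registers. [c] is not needed, so register 1 is
   pointed beyond the input (n >= 2 makes 64 n a large enough gap) and the
   registers are freed one at a time by moving their contents there. *)
Definition boot_base : seq instr :=
  [:: IAdd 1 0 0; IAdd 1 1 1; IAdd 1 1 1; IAdd 1 1 1; IAdd 1 1 1; IAdd 1 1 1;
      IAdd 1 1 4; IAdd 1 1 4; IAdd 1 1 4].

(** Once the first [nregs] words of the edge list are saved, the other [3 * m - nregs] lie above all
    working registers, and a loop can move them. *)
Definition boot_setup : seq instr :=
  [:: IConst 10 1; IConst 11 16; IConst 8 (5 + nregs); IConst 12 0; IAdd 9 1 12;
      IAdd 7 4 4; IAdd 7 7 4; IConst 12 nregs; ISub 7 7 12].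

Definition boot_with k : seq instr :=
  boot_base ++ save_cells k ++ boot_setup ++
  copy_loop (9 + 3 * k + 9) 10 11 7 ++ [:: IConst 12 (16 * nregs); ISub 1 1 12].

Lemma code_at_boot P k : code_at P 0 (boot_with k) ->
  [/\ code_at P 0 boot_base, code_at P 9 (save_cells k),
      code_at P (9 + 3 * k) boot_setup,
      code_at P (9 + 3 * k + 9) (copy_loop (9 + 3 * k + 9) 10 11 7) &
      code_at P (9 + 3 * k + 9 + 7) [:: IConst 12 (16 * nregs); ISub 1 1 12]].
Proof.
rewrite /boot_with !code_at_cat size_save_cells (_ : size boot_base = 9) //.
rewrite (_ : size boot_setup = 9) // (_ : size (copy_loop _ _ _ _) = 7) // add0n.
by case=> ? [? [? [? ?]]].
Qed.

Definition boot := boot_with nregs.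
Definition boot_size := 9 + 3 * nregs + 9 + 7 + 2.

Lemma size_boot : size boot = boot_size.
Proof. by []. Qed.

(** Memory beyond the input is zero, so every array except the input starts at 0. The list heads and
    [aDone] rely on this instead of being initialised, which keeps [c] out of the running time. *)
Lemma boot_ok P (M : memory) n m :
  code_at P 0 boot -> 1 < n -> M 0 = n -> M 4 = m ->
  (forall y, 5 + 3 * m <= y -> M y = 0) ->
  exists M' N, [/\ reaches P N (0, M) (boot_size, M'), N <= 200 + 21 * m,
    represents (64 * n + 3 * m) M' M' (fun k i => if k == 0 then M (5 + i) else 0) &
    forall y, y \in [:: 0; 2; 3; 4] -> M' y = M y].
Proof.
have nrE : nregs = 40 by [].
move=> + n1 M0 M4 M0s; set B := 64 * n + 3 * m.
have leB : 5 + 3 * m + 120 <= B by rewrite /B; lia.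
case/code_at_boot=> cb cs cu cc [g1 [g2 _]].
case: cb => [f0 [f1 [f2 [f3 [f4 [f5 [f6 [f7 [f8 _]]]]]]]]].
have [M1 [r1 v1]] : exists M1, reaches P 9 (0, M) (9, M1) /\
    forall y, M1 y = if y == 1 then B else M y.
  eexists; split.
    rewrite /reaches (exec_step _ _ f0) /= (exec_step _ _ f1) /= (exec_step _ _ f2) /=.
    rewrite (exec_step _ _ f3) /= (exec_step _ _ f4) /= (exec_step _ _ f5) /=.
    by rewrite (exec_step _ _ f6) /= (exec_step _ _ f7) /= (exec_step _ _ f8) /= exec0.
  by move=> y; rewrite /upd /= M0 M4; case: eqP => // _; rewrite !addnn -!muln2 /B; lia.
have [|||M2 [r2 v2 w2 o2]] := @save_cells_ok P 9 B M1 nregs cs; try lia.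
  by rewrite v1.
case: cu => [h0 [h1 [h2 [h3 [h4 [h5 [h6 [h7 [h8 _]]]]]]]]].
have low y : y \in [:: 0; 2; 3; 4] -> M2 y = M y.
  move=> hy; have lty : y < 5 by move: hy; rewrite !inE; lia.
  have y1 : y <> 1 by move=> y1; rewrite y1 in hy.
  rewrite o2 //; [rewrite v1; case: eqP => // | left; lia | move=> i _; lia].
have M24 : M2 4 = m by rewrite low.
have [M3 [r3 v3]] : exists M3,
    reaches P 9 (9 + 3 * nregs, M2) (9 + 3 * nregs + 9, M3) /\
    forall y, M3 y = if y == 7 then 3 * m - nregs else if y == 8 then 5 + nregs else
      if y == 9 then B + 16 * nregs else if y == 10 then 1 else if y == 11 then 16 else
      if y == 12 then nregs else M2 y.
  eexists; split.
    rewrite /reaches (exec_step _ _ h0) /= (exec_step _ _ h1) /= (exec_step _ _ h2) /=.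
    rewrite (exec_step _ _ h3) /= (exec_step _ _ h4) /= (exec_step _ _ h5) /=.
    by rewrite (exec_step _ _ h6) /= (exec_step _ _ h7) /= (exec_step _ _ h8) /= exec0.
  by move=> y; rewrite !updE /= M24 v2; do ![case: eqP => ?]; lia.
have [||||||||||||M4' [r4 w4 o4]] := copy_loop_ok cc _ _ _ _ (k := 3 * m - nregs) (M := M3)
  (src := 5 + nregs) (dst := B + 16 * nregs) => //.
all: try by rewrite v3.
  by rewrite nrE; lia.
  by rewrite !v3 /= => i j ltij ltj; lia.
rewrite !v3 /= in w4 o4.
have [M5 [r5 v5]] : exists M5,
    reaches P 2 (9 + 3 * nregs + 9 + 7, M4') (boot_size, M5) /\
    forall y, M5 y = if y == 1 then B else if y == 12 then 16 * nregs else M4' y.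
  eexists; split; first by rewrite /reaches (exec_step _ _ g1) /= (exec_step _ _ g2) /= exec0.
  move=> y; rewrite !updE /=.
  have -> : M4' 1 = B + 16 * nregs.
    by rewrite o4 //; [rewrite v3 /= v2 | move=> i _; lia].
  do ![case: eqP => ?]; lia.
exists M5, (9 + (3 * nregs + (9 + (7 * (3 * m - nregs) + 1 + 2)))); split.
- apply: reaches_trans r1 _; apply: reaches_trans r2 _; apply: reaches_trans r3 _.
  by apply: reaches_trans r4 r5.
- by rewrite nrE; lia.
- split=> [|//|k i ltk]; first by rewrite v5.
  have -> : M5 (B + 16 * i + k) = M4' (B + 16 * i + k).
    by rewrite v5; do ![case: eqP => ?]; lia.
  have M23 j : j <> 1 -> 12 < j -> (forall i, i < nregs -> j <> B + 16 * i) -> M3 j = M j.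
    move=> j1 j12 jn; rewrite v3; do ![case: eqP => ?]; try lia.
    by rewrite o2 //; [rewrite v1; case: eqP | left; lia].
  case: eqP => [-> | k0]; last first.
    rewrite o4; [rewrite M23 ?M0s; lia | by rewrite !inE; lia | by move=> j; lia].
  rewrite addn0; have [lti|gei] := ltnP i nregs.
    rewrite o4; last by move=> j; lia.
      rewrite v3; do ![case: eqP => ?]; try lia.
      by rewrite w2 // v1.
    by rewrite !inE; lia.
  have [lt3|ge3] := ltnP i (3 * m).
    have := w4 (i - nregs).
    rewrite (_ : B + 16 * nregs + (i - nregs) * 16 = B + 16 * i); last lia.
    move=> ->; last lia.
    rewrite (_ : 5 + nregs + (i - nregs) * 1 = 5 + i); last lia.
    by apply: M23; lia.
  rewrite o4; [rewrite M23 ?M0s; lia | by rewrite !inE; lia | by move=> j; lia].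
- move=> y hy; have lty : y < 5 by move: hy; rewrite !inE; lia.
  have y1 : y <> 1 by move=> y1; rewrite y1 in hy.
  rewrite v5; do ![case: eqP => ?]; try lia.
  rewrite o4; [|by rewrite !inE; lia | by move=> i _; lia].
  by rewrite v3; do ![case: eqP => ?]; try lia; rewrite low.
Qed.

(** The decoder reads consecutive cells, whereas array 1 has stride 16; the block is packed so as to
    start at [B]. *)
Definition emit cnt pc : seq instr :=
  [:: IConst 10 1; IConst 11 16; IAdd 8 1 10; IConst 12 0; IAdd 9 1 12] ++
  copy_loop (pc + 5) 11 10 cnt ++ [:: IConst 12 0; IAdd 0 1 12; IHalt].

Lemma emit_ok P pc B M r a cnt :
  code_at P pc (emit cnt pc) -> nregs <= B -> represents B M r a -> okvar cnt ->
  cnt \notin [:: 8; 9; 10; 11; 12] ->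
  exists M' N, [/\ halted P (exec P N (pc, M)), (exec P N (pc, M)).2 = M',
    N <= 7 * r cnt + 8, M' 0 = B & forall i, i < r cnt -> M' (B + i) = a 1 i].
Proof.
have nrE : nregs = 40 by [].
have nvE : nvars = 30 by [].
rewrite !code_at_cat => -[[f0 [f1 [f2 [f3 [f4 _]]]]] [cc [g0 [g1 [g2 _]]]]] leB.
case=> M1 Mr Ma okc nc; have [ltc _] := andP okc.
have [M3 [r3 v3]] : exists M3, reaches P 5 (pc, M) (pc + 5, M3) /\
    forall y, M3 y = if y == 8 then B + 1 else
      if y == 9 then B else if y == 10 then 1 else if y == 11 then 16 else
      if y == 12 then 0 else M y.
  eexists; split.
    have -> : pc + 5 = pc.+4.+1 by lia.
    rewrite /reaches (exec_step _ _ f0) /= (exec_step _ _ f1) /= (exec_step _ _ f2) /=.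
    by rewrite (exec_step _ _ f3) /= (exec_step _ _ f4) /= exec0.
  by move=> y; rewrite !updE /= M1; do ![case: eqP => ?]; lia.
have [||||||||||||M4 [r4 w4 o4]] := copy_loop_ok cc _ _ _ _ (k := r cnt) (M := M3)
  (src := B + 1) (dst := B) => //.
all: try by rewrite v3.
all: try lia.
- by rewrite v3 -Mr //; move: nc; rewrite !inE; do ![case: eqP => //= ?].
- by rewrite !v3 /= => i j ltij ltj; lia.
rewrite !v3 /= in w4 o4.
have M41 : M4 1 = B.
  by rewrite o4 ?v3 //; [rewrite !inE; case/andP: okc; lia | move=> i; lia].
have e : exec P (5 + (7 * r cnt + 1 + 2)) (pc, M) =
    (pc + 5 + 7 + 2, upd (upd M4 12 0) 0 B).
  apply: reaches_trans r3 _; apply: reaches_trans r4 _.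
  rewrite /reaches (exec_step _ _ g0) /= (exec_step _ _ g1) /= exec0 !updE /= M41 addn0.
  by rewrite !addnS !addn0.
exists (upd (upd M4 12 0) 0 B), (5 + (7 * r cnt + 1 + 2)); split=> //.
- by rewrite e /halted /= !addnS !addn0 in g2 *; rewrite g2.
- by rewrite e.
- lia.
- move=> i lti; rewrite !updE; do ![case: eqP => ?]; try lia.
  have := w4 i lti; rewrite muln1 => ->.
  have -> : B + 1 + i * 16 = B + 16 * i + 1 by lia.
  by rewrite v3 -Ma //; do ![case: eqP => ?]; lia.
Qed.

(** * Augmentation and the cut *)

Section Menger.
Variables (n s t : nat) (nb : nat -> seq nat).
Hypotheses (s_neq_t : s != t) (lt_sn : s < n) (lt_tn : t < n).
Hypothesis nb_lt : forall u v, v \in nb u -> v < n.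
Hypothesis nb_sym : forall u v, (v \in nb u) = (u \in nb v).

Definition inner v := [&& v < n, v != s & v != t].

(* [nx] sends a vertex of a current path to its successor and an unused vertex to
   itself; [S] lists the first inner vertices of the current paths.  With a nonempty
   [H] the conditions may fail at the vertices of [H]. *)
Record linking_but (H : pred nat) (nx : nat -> nat) (S : seq nat) : Prop := LinkingBut {
  link_uniq : uniq S;
  link_start : forall x, x \in S -> inner x /\ s \in nb x;
  link_step : forall v, inner v -> nx v = t \/ inner (nx v);
  link_adj : forall v, inner v -> nx v = v \/ nx v \in nb v;
  link_notin : forall v, inner v -> ~~ H v -> nx v \notin S;
  link_inj : forall v w, inner v -> inner w -> ~~ H v -> ~~ H w ->
    nx v = nx w -> nx v <> t -> v = w;
  link_surj : forall x, inner x -> x \notin S ->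
    exists v, [/\ inner v, ~~ H v & nx v = x] }.

Definition linking := linking_but pred0.

Lemma linking_id nx : (forall v, v < n -> nx v = v) -> linking nx [::].
Proof.
move=> nxE; split=> //.
- by move=> v iv; right; rewrite nxE //; case/andP: iv.
- by move=> v /andP[ltv _]; left; apply: nxE.
- move=> v w /andP[ltv _] /andP[ltw _] _ _; by rewrite !nxE.
- by move=> x ix _; exists x; rewrite nxE //; case/andP: ix.
Qed.

(** A tree edge from [par x] to [x] passes through [via x], the vertex that would be redirected from
    [x] to [par x]. Parents come earlier in the queue, which makes the walk back to [t] finite. *)
Definition tree_node (nx par via : nat -> nat) (Q : seq nat) j :=
  let x := nth 0 Q j in
  [/\ inner x, inner (via x), nx (via x) = x,
      via x = par x \/ via x \in nb (par x) &
      exists2 l, l < j & par x = nth 0 Q l].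

Record search_tree nx par via (Q : seq nat) : Prop := SearchTree {
  tree_uniq : uniq Q;
  tree_gt0 : 0 < size Q;
  tree_root : nth 0 Q 0 = t;
  tree_nodes : forall j, 0 < j < size Q -> tree_node nx par via Q j }.

Lemma search_tree_root nx par via : search_tree nx par via [:: t].
Proof. by split=> //= -[|j]. Qed.

Lemma search_tree_rcons nx par via Q u w x :
  search_tree nx par via Q -> x \notin Q -> inner x -> inner w -> nx w = x ->
  w \in u :: nb u -> u \in Q ->
  search_tree nx (setv par x u) (setv via x w) (rcons Q x).
Proof.
move=> [uQ gt0 root nodes] xQ ix iw nw wu uinQ; split.
- by rewrite rcons_uniq xQ.
- by rewrite size_rcons.
- by rewrite nth_rcons gt0.
- move=> j /andP[j0]; rewrite size_rcons ltnS leq_eqVlt => /orP[/eqP ->|ltj].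
    rewrite /tree_node nth_rcons ltnn eqxx !setvE eqxx; split=> //.
      by move: wu; rewrite inE => /orP[/eqP|]; auto.
    by exists (index u Q); rewrite ?nth_rcons ?index_mem ?uinQ ?nth_index.
  have := nodes j; rewrite j0 ltj => /(_ isT).
  have neq : nth 0 Q j != x by apply: contra xQ => /eqP <-; apply: mem_nth.
  rewrite /tree_node nth_rcons ltj !setvE (negPf neq) => -[? ? ? ? [l ltl pE]].
  by split=> //; exists l => //; rewrite nth_rcons pE (ltn_trans ltl ltj).
Qed.

(** Invariant of the rerouting: [u] has just received a second predecessor, so the conditions are
    suspended at the old one, [via u]. At [t] nothing is suspended. The last clause says that [nx]
    still has its original values on the tree up to index [j]. *)
Definition augmenting via Q S nx u j :=
  [/\ j < size Q, u = nth 0 Q j,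
      linking_but (fun v => (u != t) && (v == via u)) nx S &
      forall l, 0 < l <= j -> nx (via (nth 0 Q l)) = nth 0 Q l].

Lemma tree_inner nx par via Q u :
  search_tree nx par via Q -> u \in Q -> u != t -> inner u.
Proof.
move=> [_ _ root nodes] uQ ut.
have j0 : 0 < index u Q.
  by rewrite lt0n; apply: contra ut => /eqP j0; rewrite -(nth_index 0 uQ) j0 root.
by have := nodes (index u Q); rewrite j0 index_mem uQ => /(_ isT) []; rewrite nth_index.
Qed.

Lemma tree_via nx par via Q u :
  search_tree nx par via Q -> u \in Q -> u != t -> inner (via u).
Proof.
move=> [_ _ root nodes] uQ ut.
have j0 : 0 < index u Q.
  by rewrite lt0n; apply: contra ut => /eqP j0; rewrite -(nth_index 0 uQ) j0 root.
by have := nodes (index u Q); rewrite j0 index_mem uQ => /(_ isT) []; rewrite nth_index.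
Qed.

Lemma augmenting_start nx par via Q S u :
  linking nx S -> search_tree nx par via Q -> u \in Q -> u != t -> s \in nb u ->
  augmenting via Q (rcons S u) nx u (index u Q).
Proof.
move=> [lu ls lst la lni lin lsu] T uQ ut su.
have [uQ' gt0 root nodes] := T.
have iu := tree_inner T uQ ut.
have jgt : 0 < index u Q.
  by rewrite lt0n; apply: contra ut => /eqP j0; rewrite -(nth_index 0 uQ) j0 root.
have jlt : index u Q < size Q by rewrite index_mem.
have := nodes (index u Q); rewrite jgt jlt => /(_ isT) [].
rewrite nth_index // => _ iv nv _ _.
split=> //; first by rewrite nth_index.
  have uS : u \notin S by rewrite -nv; apply: lni.
  split=> //.
  - by rewrite rcons_uniq uS.
  - by move=> x; rewrite mem_rcons inE => /orP[/eqP -> | /ls].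
  - move=> v iV; rewrite ut /= => nvu; rewrite mem_rcons inE negb_or lni // andbT.
    apply: contra nvu => /eqP nvu; apply/eqP; apply: lin => //; first by rewrite nvu.
    by rewrite nvu; apply/eqP.
  - by move=> v w iV iW _ _; apply: lin.
  - move=> x ix; rewrite mem_rcons inE negb_or => /andP[xu /lsu-/(_ ix)[v [iV _ nvx]]].
    exists v; split=> //; rewrite ut /=; apply: contra xu => /eqP ev.
    by rewrite -nvx ev nv.
move=> l /andP[l0 lj]; have := nodes l; rewrite l0 => /(_ _) [] //.
exact: leq_ltn_trans lj jlt.
Qed.

Lemma augmenting_step nx0 par via Q S nx u j :
  search_tree nx0 par via Q -> augmenting via Q S nx u j -> u <> t ->
  exists2 j', j' < j & augmenting via Q S (setv nx (via u) (par u)) (par u) j'.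
Proof.
move=> [uQ gt0 root nodes] [jlt uE [lu ls lst la lni lin lsu] ch] /eqP ut.
rewrite ut /= in lni lin lsu.
have jgt : 0 < j by case: j uE {jlt ch} => // uE; rewrite uE root eqxx in ut.
have := nodes j; rewrite jgt jlt => /(_ isT); rewrite /tree_node -uE.
move=> [iu iv _ pv [j' ltj pE]]; exists j' => //.
have j'lt : j' < size Q by apply: ltn_trans jlt.
have nxv : nx (via u) = u by rewrite uE; apply: ch; rewrite jgt /=.
(* Since [nx] sends each [via] to its own queue entry, distinct entries have distinct [via]; the
   redirection thus leaves the tree below [u] in the queue intact. *)
have vneq l : 0 < l <= j' -> via (nth 0 Q l) != via u.
  move=> /andP[l0 lj]; apply/eqP => ve.
  have : nth 0 Q l = u by rewrite -nxv -ve; symmetry; apply: ch; lia.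
  move/eqP; rewrite uE nth_uniq //; last exact: leq_ltn_trans lj j'lt.
  by move/eqP; lia.
split=> //; last first.
  move=> l hl; rewrite setvE (negPf (vneq l hl)); apply: ch; lia.
have pcase : par u = t \/ [/\ par u <> t, inner (par u), inner (via (par u)),
    nx (via (par u)) = par u & via (par u) != via u].
  have [j0|j0] := posnP j'; first by left; rewrite pE j0 root.
  right; have := nodes j'; rewrite j0 j'lt => /(_ isT) [].
  rewrite -pE => ip ivp _ _ _; split=> //.
  - by case/and3P: ip => _ _ /eqP.
  - by rewrite pE; apply: ch; lia.
  - by rewrite pE; apply: vneq; lia.
split=> //.
- move=> v iV; rewrite setvE; case: eqP => _; last exact: lst.
  by case: pcase => [->|[]]; auto.
- move=> v iV; rewrite setvE; case: eqP => [->|_]; last exact: la.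
  by case: pv => [->|]; [left | right; rewrite nb_sym].
- move=> v iV nH; rewrite setvE; case: eqP => [ev|/eqP nev]; last exact: lni.
  case: pcase => [-> | [pt ip ivp np nev]].
    by apply/negP => /ls[/and3P[_ _]]; rewrite eqxx.
  by rewrite -np; apply: lni.
- move=> v w iV iW nHv nHw; rewrite !setvE.
  have aux x : inner x -> ~~ ((par u != t) && (x == via (par u))) -> x <> via u ->
      par u <> t -> nx x <> par u.
    move=> ix nH /eqP nx1 pt; case: pcase => [// | [_ ip ivp np nev]].
    rewrite -np => e; move: nH; rewrite (introF eqP pt) /=.
    by case/negP; apply/eqP; apply: lin => //; rewrite e np.
  case: eqP => [-> | nv]; case: eqP => [-> // | nw].
  + by move=> e pt; case: (aux w iW nHw nw pt).
  + by move=> e pt; case: (aux v iV nHv nv); rewrite -?e.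
  + by move=> e ne; apply: lin => //; apply/eqP.
- move=> x ix xS; have [v [iV nH nvx]] := lsu x ix xS.
  case: (pcase) => [pt | [pt ip ivp np nev]].
    by exists v; rewrite pt eqxx /= setvE (negPf nH).
  rewrite (introF eqP pt) /=.
  case: (v =P via (par u)) => [ev | /eqP nv]; last first.
    by exists v; rewrite setvE (negPf nH).
  (* Here [x] is [par u]: its old preimage is now the exempted vertex, and the redirected [via u]
     takes its place. *)
  exists (via u); rewrite setvE eqxx eq_sym; split=> //.
  by rewrite -nvx ev np.
Qed.

Lemma augmenting_end via Q S nx j : augmenting via Q S nx t j -> linking nx S.
Proof. by case=> _ _ [? ? ? ? lni lin lsu] _; rewrite eqxx /= in lni lin lsu; split. Qed.

Lemma linking_size nx S : linking nx S -> size S <= n.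
Proof.
move=> [lu ls _ _ _ _ _]; rewrite -[n](size_iota 0); apply: uniq_leq_size => // x xS.
by rewrite mem_iota add0n; case: (ls x xS) => /and3P[].
Qed.

Lemma linking_size_nb nx S : linking nx S -> size S <= size (nb s).
Proof.
move=> [lu ls _ _ _ _ _]; apply: uniq_leq_size => // x xS.
by rewrite nb_sym; case: (ls x xS).
Qed.

(** * The cut left by a failed search, and maximality *)

Section Cut.
Variables (nx par via : nat -> nat) (Q S : seq nat).
Hypotheses (L : linking nx S) (T : search_tree nx par via Q).
Hypothesis closed : forall u w, u \in Q -> w \in u :: nb u -> w <> s -> nx w \in Q.
Hypothesis no_exit : forall u, u \in Q -> u != t -> s \notin nb u.

Definition fringe w := has (fun u => w \in u :: nb u) Q.
Definition cut := [seq w <- iota 0 n | [&& inner w, fringe w & w \notin Q]].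

(* With W the inner vertices of the fringe and R those of [Q], [nx] maps W into
   R + {t} and is injective off t, while only [size S] vertices are sent to t. *)
Lemma size_cut : size cut <= size S.
Proof.
have [lu ls lst la lni lin lsu] := L; have [uQ gt0 root nodes] := T.
pose I := [seq w <- iota 0 n | inner w].
have uI : uniq I by rewrite filter_uniq ?iota_uniq.
have memI w : (w \in I) = inner w.
  by rewrite mem_filter mem_iota add0n leq0n /inner; case: (w < n); rewrite ?andbT ?andbF.
pose R := [seq w <- Q | inner w].
pose W := [seq w <- I | fringe w].
have uW : uniq W by rewrite filter_uniq.
have cutE : cut = [seq w <- W | w \notin Q].
  rewrite /cut /W /I -!filter_predI; apply: eq_filter => w /=.
  by case: (inner w); case: (fringe w); case: (w \notin Q).
have szW : size W = size [seq w <- W | w \in Q] + size cut.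
  by rewrite cutE !(size_filter _ W); apply/esym; apply: count_predC.
have szWQ : size R <= size [seq w <- W | w \in Q].
  apply: uniq_leq_size; first by rewrite filter_uniq.
  move=> w; rewrite (mem_filter _ _ Q) => /andP[iw wQ].
  rewrite (mem_filter _ _ W) (mem_filter _ _ I) memI wQ iw andbT /=.
  by apply/hasP; exists w => //; rewrite mem_head.
pose nt := [pred w | nx w != t].
have inj_nt (X : seq nat) : {subset X <= I} -> {in filter nt X &, injective nx}.
  move=> XI v w; rewrite !mem_filter /= => /andP[/eqP tv /XI]; rewrite memI => iv.
  by move=> /andP[_ /XI]; rewrite memI => iw e; apply: lin.
have WI : {subset W <= I} by move=> w; rewrite (mem_filter _ _ I) => /andP[].
have szW1 : size (filter nt W) <= size R.
  rewrite -(size_map nx); apply: uniq_leq_size.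
    by rewrite (map_inj_in_uniq (inj_nt W WI)) (filter_uniq nt uW).
  move=> x /mapP[w]; rewrite (mem_filter _ _ W) => /andP[/= ntw wW] ->.
  have := wW; rewrite (mem_filter _ _ I) memI => /andP[/hasP[u uQ' wu] iw].
  rewrite (mem_filter _ _ Q) (closed uQ' wu) ?andbT; last by case/and3P: iw => _ /eqP.
  by case: (lst w iw) => // e; rewrite e eqxx in ntw.
have szW2 : size W = size (filter nt W) + size (filter (predC nt) W).
  by rewrite !(size_filter _ W); apply/esym; apply: count_predC.
have szI2 : size I = size (filter nt I) + size (filter (predC nt) I).
  by rewrite !(size_filter _ I); apply/esym; apply: count_predC.
have le1 : size (filter (predC nt) W) <= size (filter (predC nt) I).
  apply: uniq_leq_size; first by rewrite filter_uniq.
  by move=> w; rewrite !(mem_filter (predC nt)) => /andP[-> /WI].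
(* Every inner vertex is a start or an image under [nx], so at most [size S] inner vertices are sent
   to [t]; the cut is then compared with those of them that lie in W. *)
have le2 : size I <= size (filter nt I) + size S.
  rewrite -(size_map nx (filter nt I)) -size_cat.
  apply: uniq_leq_size => // x; rewrite memI mem_cat => ix.
  have [xS|xS] := boolP (x \in S); rewrite ?orbT // orbF.
  have [v [iv _ e]] := lsu x ix xS; rewrite -e map_f // (mem_filter _ _ I) memI iv andbT /= e.
  by case/and3P: ix.
lia.
Qed.

Lemma path_nb_lt x p :
  path (fun u v => v \in nb u) x p -> all (fun v => v < n) p.
Proof. by elim: p x => //= y p IH x /andP[/nb_lt -> /IH]. Qed.

(** Separation, propagated backwards from [t]: a vertex whose successor is reached lies in the
    fringe, so outside the cut it must be reached too. *)
Lemma path_meets_cut x p :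
  path (fun u v => v \in nb u) x p -> last x p = t -> s \notin x :: p ->
  all (fun v => v < n) (x :: p) -> ~~ has (mem cut) (x :: p) -> x \in Q.
Proof.
have [uQ gt0 root nodes] := T.
elim: p x => [|y p IH] x /=.
  by move=> _ -> _ _ _; rewrite -root mem_nth.
move=> /andP[xy pp] lp; rewrite !inE negb_or => /andP[sx sp] /andP[xn an].
rewrite negb_or => /andP[xc hc].
have yQ : y \in Q by apply: IH => //; rewrite inE.
case: (x =P t) => [-> | /eqP xt]; first by rewrite -root mem_nth.
apply: contraT => xQ; case/negP: xc.
rewrite /= mem_filter mem_iota add0n xn /inner xn eq_sym sx xt xQ /= !andbT.
by apply/hasP; exists y => //; rewrite inE nb_sym xy orbT.
Qed.

(** Each path other than the direct one is mapped to its first vertex in the cut, and disjointness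
    makes this map injective. The direct path occurs at most once because [F] is duplicate-free and
    has a single colour. *)
Lemma family_bound (E : seq cedge) i c F :
  (forall u v, adj E i u v = (v \in nb u)) ->
  cdp_family c E s t F -> all (fun p => p.1 == i) F ->
  size F <= size S + (s \in nb t).
Proof.
move=> adjE /and3P[uF pF dF] aF.
pose direct := [pred p : cpath | p.2 == [:: s; t]].
have -> : size F = size (filter (predC direct) F) + size (filter direct F).
  by rewrite !size_filter addnC count_predC.
have ucp p : p \in F -> ucpath E s t i p.2.
  by move=> pin; have /andP[_] := allP pF p pin; have /eqP -> := allP aF p pin.
apply: leq_add.
  apply: leq_trans size_cut.
  pose f (p : cpath) := nth 0 p.2 (find (mem cut) p.2).
  have fP p : p \in filter (predC direct) F -> f p \in internal s t p /\ f p \in cut.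
    rewrite mem_filter => /andP[/= nd pin].
    have hc : has (mem cut) p.2.
      move: (ucp p pin) nd; case: p.2 => // x [|y q] /=.
        by case/and3P=> /eqP -> st; rewrite (negPf s_neq_t) in st.
      case/and4P=> /eqP -> /andP[xy pq] /eqP lq /and3P[sy yq _] nd.
      apply: contraT; rewrite negb_or => /andP[_ nh].
      have pq' : path (fun u v => v \in nb u) y q.
        by rewrite -(eq_path (e := adj E i)).
      (* A path missing the cut has a reached second vertex [y]; being adjacent to [s], it can only
         be [t], and since vertices do not repeat the path is the direct one. *)
      have yQ : y \in Q.
        apply: (path_meets_cut pq') => //=.
        by rewrite (path_nb_lt pq') andbT; rewrite adjE in xy; apply: nb_lt xy.
      rewrite adjE nb_sym in xy.
      have [yt|yt] := eqVneq y t; last by rewrite (negPf (no_exit yQ yt)) in xy.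
      case: q lq nd yq {pq pq' sy nh} => [|z q] /= lq nd; first by rewrite yt eqxx in nd.
      by rewrite yt -[X in X \notin _]lq mem_last.
    have fc : f p \in cut by apply: (nth_find 0 hc).
    split=> //; rewrite mem_filter mem_nth -?has_find // andbT.
    by move: fc; rewrite mem_filter => /andP[/and3P[/and3P[_ -> ->]]].
  rewrite -(size_map f); apply: uniq_leq_size; last first.
    by move=> x /mapP[p /fP[_ fc] ->].
  have := fP; have : pairwise (int_disjoint s t) (filter (predC direct) F).
    exact: pairwise_filter.
  elim: (filter _ F) => //= p G IH /andP[ap pG] fPG.
  rewrite IH ?andbT //; last by move=> q qG; apply: fPG; rewrite inE qG orbT.
  apply/negP => /mapP[q qG e]; have := allP ap q qG; case/negP; apply/hasP.
  exists (f p); first by case: (fPG p (mem_head _ _)).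
  by rewrite e; case: (fPG q); rewrite ?inE ?qG ?orbT.
have dE p : p \in filter direct F -> p = (i, [:: s; t]).
  rewrite mem_filter => /andP[/= /eqP d pin].
  by rewrite [p]surjective_pairing d; have /eqP -> := allP aF p pin.
case eF: (filter direct F) => [//|p G].
have pin : p \in filter direct F by rewrite eF mem_head.
have -> : s \in nb t.
  have := pin; rewrite mem_filter => /andP[_ /ucp]; rewrite (dE p pin) /=.
  by rewrite andbT adjE nb_sym => /and4P[].
case: G eF => // q G eF.
have : uniq (filter direct F) by rewrite filter_uniq.
rewrite eF /= inE (dE p pin) (dE q) ?eqxx //.
by rewrite eF !inE eqxx orbT.
Qed.

End Cut.

(** * Reading disjoint paths off a linking *)

Section Traces.
Variables (nx : nat -> nat) (S : seq nat).
Hypothesis L : linking nx S.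

Definition on_path w j := forall i, i < j -> inner (iter i nx w).

Lemma on_pathS w j : on_path w j -> inner (iter j nx w) -> on_path w j.+1.
Proof. by move=> op ij i; rewrite ltnS leq_eqVlt => /orP[/eqP -> //|]; apply: op. Qed.

(** Injectivity pulls a common vertex back along both orbits until one of them is at its start,
    which has no preimage. This gives disjointness of different paths and, for [w = w'], absence of
    repetition. *)
Lemma iter_link_inj w w' a b : w \in S -> w' \in S ->
  on_path w a.+1 -> on_path w' b.+1 -> iter a nx w = iter b nx w' -> a = b /\ w = w'.
Proof.
have [_ ls _ _ lni lin _] := L.
elim: a b => [|a IH] [|b] wS w'S oa ob //=.
- by move=> e; have := lni _ (ob b (leqnSn _)) isT; rewrite -e wS.
- by move=> e; have := lni _ (oa a (leqnSn _)) isT; rewrite e w'S.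
- move=> e; case: (IH b) => //.
  + by move=> i li; apply: oa; lia.
  + by move=> i li; apply: ob; lia.
  + apply: lin => //; [by apply: oa; lia | by apply: ob; lia |].
    by have /and3P[_ _ /eqP] := oa a.+1 (ltnSn _).
  + by move=> -> ->.
Qed.

Lemma on_path_uniq w j : w \in S -> on_path w j -> uniq (mkseq (fun i => iter i nx w) j).
Proof.
move=> wS oj; apply/(mkseq_uniqP _ j) => a b.
rewrite !inE => la lb e; case: (iter_link_inj wS wS _ _ e) => //.
  by move=> i li; apply: oj; lia.
by move=> i li; apply: oj; lia.
Qed.

Lemma on_path_le w j : w \in S -> on_path w j -> j <= n.
Proof.
move=> wS oj; rewrite -[j](size_mkseq (fun i => iter i nx w)) -[n](size_iota 0).
apply: uniq_leq_size; first exact: on_path_uniq.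
move=> x /mapP[i]; rewrite mem_iota add0n => /= li ->.
by rewrite mem_iota add0n; have /andP[] := oj i li.
Qed.

Lemma on_path_next w j : w \in S -> on_path w j ->
  iter j nx w = t \/ inner (iter j nx w).
Proof.
have [_ ls lst _ _ _ _] := L.
by case: j => [|j] wS oj; [right; case: (ls w wS) | apply: lst; apply: oj].
Qed.

Definition trace_len w := find (fun i => iter i nx w == t) (iota 0 n.+1).
Definition trace w := s :: rcons (mkseq (fun i => iter i nx w) (trace_len w)) t.

Lemma trace_lenE w j : w \in S -> on_path w j -> iter j nx w = t -> trace_len w = j.
Proof.
move=> wS oj e; have lej := on_path_le wS oj.
have h : has (fun i => iter i nx w == t) (iota 0 n.+1).
  by apply/hasP; exists j; rewrite ?mem_iota ?e ?eqxx //; lia.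
have := h; rewrite has_find size_iota => lt; have := nth_find 0 h.
rewrite nth_iota // add0n => /eqP te.
have [ltj|gtj|//] := ltngtP (trace_len w) j.
  by have /and3P[_ _] := oj _ ltj; rewrite te eqxx.
have := before_find 0 gtj; rewrite nth_iota; last by lia.
by rewrite add0n e eqxx.
Qed.

(** An orbit that stays inner has distinct vertices, hence at most [n] of them, so it must reach
    [t]. *)
Lemma trace_end w : w \in S ->
  [/\ trace_len w <= n, on_path w (trace_len w) & iter (trace_len w) nx w = t].
Proof.
move=> wS.
suff [j oj e] : exists2 j, on_path w j & iter j nx w = t.
  by rewrite (trace_lenE wS oj e); split=> //; apply: on_path_le oj.
have [k] : exists k, n < k by exists n.+1.
suff H : on_path w k \/ exists2 j, on_path w j & iter j nx w = t.
  by case: H => // ok; have := on_path_le wS ok; lia.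
elim: k => [|k [ok|ex]]; [by left | | by right].
have [e|ik] := on_path_next wS ok; first by right; exists k.
by left; apply: on_pathS.
Qed.

Lemma trace_inner w v : w \in S -> v \in mkseq (fun i => iter i nx w) (trace_len w) ->
  inner v.
Proof.
move=> wS /mapP[i]; rewrite mem_iota add0n => /= li ->.
by have [_ + _] := trace_end wS; apply.
Qed.

Lemma trace_len_gt0 w : w \in S -> 0 < trace_len w.
Proof.
have [_ ls _ _ _ _ _] := L.
move=> wS; have [_ _ e] := trace_end wS; case: (trace_len w) e => // wt.
by have [/and3P[_ _]] := ls w wS; rewrite -wt eqxx.
Qed.

Lemma internal_trace w c : w \in S ->
  internal s t (c, trace w) = mkseq (fun i => iter i nx w) (trace_len w).
Proof.
move=> wS; rewrite /internal /= eqxx /= -cats1 filter_cat /= eqxx andbF cats0.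
apply/all_filterP/allP => v /(trace_inner wS) /and3P[_ -> ->] //.
Qed.

Lemma trace_ucpath E i w : (forall u v, adj E i u v = (v \in nb u)) -> w \in S ->
  ucpath E s t i (trace w).
Proof.
have [_ ls _ la lni lin _] := L.
move=> adjE wS; have [_ op e] := trace_end wS.
have gt0 := trace_len_gt0 wS.
rewrite /ucpath /trace eqxx last_rcons eqxx andTb andTb; apply/andP; split; last first.
  rewrite cons_uniq mem_rcons inE negb_or s_neq_t rcons_uniq on_path_uniq // andbT.
  by apply/andP; split; apply/negP => /(trace_inner wS) /and3P[_]; rewrite eqxx ?andbF.
have -> : rcons (mkseq (fun i => iter i nx w) (trace_len w)) t =
    mkseq (fun i => iter i nx w) (trace_len w).+1 by rewrite mkseqS e.
apply/(pathP 0) => j; rewrite size_mkseq ltnS => lej; rewrite adjE.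
case: j lej => [|j] lej; first by rewrite /= nb_sym; case: (ls w wS).
rewrite [nth _ (_ :: _) _]/= !nth_mkseq //; try lia.
(* An orbit contains no fixed point of [nx]: at the start it would be a preimage of a start, and
   later on injectivity would identify it with the vertex before it. *)
have ij := op j lej; rewrite iterS; case: (la _ ij) => // fix_j; exfalso.
have nt : nx (iter j nx w) <> t by rewrite fix_j; apply/eqP; case/and3P: ij.
case: j lej ij fix_j nt => [|j] lej ij fix_j nt.
  by have := lni _ ij isT; rewrite fix_j wS.
have oj : on_path w j.+2 by move=> k lk; apply: op; lia.
have oj1 : on_path w j.+1 by move=> k lk; apply: op; lia.
case: (iter_link_inj wS wS oj oj1); last by lia.
apply: lin => //; apply: oj1; lia.
Qed.

Lemma trace_family E i c : i < c -> (forall u v, adj E i u v = (v \in nb u)) ->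
  cdp_family c E s t
    ((if s \in nb t then [:: (i, [:: s; t])] else [::]) ++ [seq (i, trace w) | w <- S]).
Proof.
move=> ltic adjE; have [lu ls _ _ _ _ _] := L.
have tr_inj : {in S &, injective (fun w => (i, trace w))}.
  move=> w w' wS w'S [] /rcons_inj /(congr1 fst) /= e.
  have g0 := trace_len_gt0 wS; have g0' := trace_len_gt0 w'S.
  have := congr1 (fun l => nth 0 l 0) e; rewrite !nth_mkseq //.
have dirN : (i, [:: s; t]) \notin [seq (i, trace w) | w <- S].
  apply/negP => /mapP[w wS [e]]; have g0 := trace_len_gt0 wS.
  by have := congr1 size e; rewrite size_rcons size_mkseq /=; lia.
apply/and3P; split.
- case: ifP => _; rewrite /= ?dirN map_inj_in_uniq //.
- apply/allP => p; rewrite mem_cat => /orP[|/mapP[w wS ->]]; last first.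
    by rewrite ltic trace_ucpath.
  case: ifP => // st; rewrite inE => /eqP -> /=.
  by rewrite ltic adjE nb_sym st !eqxx inE s_neq_t.
- have pS : pairwise (int_disjoint s t) [seq (i, trace w) | w <- S].
    suff H S' : uniq S' -> {subset S' <= S} ->
      pairwise (int_disjoint s t) [seq (i, trace w) | w <- S'] by apply: H.
    elim: S' => //= w S' IH /andP[wS' uS'] sub.
    have -> : pairwise (int_disjoint s t) [seq (i, trace w) | w <- S'].
      by apply: IH => // x xS; apply: sub; rewrite inE xS orbT.
    rewrite andbT.
    apply/allP => _ /mapP[w' w'S' ->]; apply/negP => /hasP[v].
    have wS : w \in S by apply: sub; rewrite mem_head.
    have w'S : w' \in S by apply: sub; rewrite inE w'S' orbT.
    rewrite !internal_trace // => /mapP[a]; rewrite mem_iota add0n => /= la ->.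
    move=> /mapP[b]; rewrite mem_iota add0n => /= lb e.
    have [_ o1 _] := trace_end wS; have [_ o2 _] := trace_end w'S.
    case: (iter_link_inj wS w'S _ _ e).
    + by move=> k lk; apply: o1; lia.
    + by move=> k lk; apply: o2; lia.
    + by move=> _ ww; rewrite ww w'S' in wS'.
  case: ifP => //= _; rewrite pS andbT; apply/allP => p _.
  by rewrite /int_disjoint /internal /= !eqxx /= andbF.
Qed.

End Traces.
End Menger.

(** * Adjacency lists and the output encoding *)

(** The recursion is on the reversed edge list, so that appending an edge conses onto the lists at
    both ends, in the order of the two pushes of [build]. *)
Fixpoint nbr_rev (r : seq cedge) i u : seq nat :=
  if r is e :: r' then
    let l := nbr_rev r' i u in
    let l1 := if (edge_col e == i) && (edge_u e == u) then edge_v e :: l else l in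
    if (edge_col e == i) && (edge_v e == u) then edge_u e :: l1 else l1
  else [::].

Definition nbr E := nbr_rev (rev E).

Lemma adj_nbr E i u v : adj E i u v = (v \in nbr E i u).
Proof.
rewrite /adj /nbr -(mem_rev E (u, v, i)) -(mem_rev E (v, u, i)).
elim: (rev E) => //= -[[a b] c] r IH; rewrite /edge_u /edge_v /edge_col /= !inE.
rewrite orbACA {}IH !xpair_eqE (eq_sym c) (eq_sym a) (eq_sym b).
rewrite !(fun_if (fun l => v \in l)) !inE !(fun_if (fun l => v \in l)) !inE.
by case: (i == c); case: (u == a); case: (u == b); case: (v == a); case: (v == b);
  case: (v \in _).
Qed.

Lemma nbr_sym E i u v : (v \in nbr E i u) = (u \in nbr E i v).
Proof. by rewrite -!adj_nbr /adj orbC. Qed.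

Lemma sum_eq_uniq (Q : seq nat) b a : uniq Q ->
  \sum_(u <- Q) nat_of_bool (b && (a == u)) <= b.
Proof.
case: b => uQ; last by rewrite big1.
rewrite (eq_bigr (fun u => if u == a then 1 else 0)); last first.
  by move=> u _; rewrite eq_sym; case: eqP.
by rewrite -big_mkcond /= sum1_count count_uniq_mem // leq_b1.
Qed.

(** Handshake bound: an edge is listed only at its two ends, and each end occurs at most once in
    [Q]. *)
Lemma sum_nbr E i (Q : seq nat) : uniq Q ->
  \sum_(u <- Q) size (nbr E i u) <= 2 * count (fun e => edge_col e == i) E.
Proof.
move=> uQ; rewrite /nbr -count_rev; elim: (rev E) => [|e r IH] /=; first by rewrite big1.
set b := edge_col e == i.
have -> : \sum_(u <- Q) size (nbr_rev (e :: r) i u) =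
  \sum_(u <- Q) ((b && (edge_v e == u)) + (b && (edge_u e == u)) + size (nbr_rev r i u)).
  by apply: eq_bigr => u _ /=; rewrite -/b; do 2!case: ifP.
rewrite !big_split /=.
have := sum_eq_uniq b (edge_u e) uQ; have := sum_eq_uniq b (edge_v e) uQ; lia.
Qed.

Lemma nbr_rcons E a b c i u : nbr (rcons E (a, b, c)) i u =
  let l := nbr E i u in let l1 := if (c == i) && (a == u) then b :: l else l in
  if (c == i) && (b == u) then a :: l1 else l1.
Proof. by rewrite /nbr rev_rcons. Qed.

Lemma nbr_take E k i u : k < size E ->
  let: (a, b, c) := nth (0, 0, 0) E k in
  nbr (take k.+1 E) i u =
  let l := nbr (take k E) i u in let l1 := if (c == i) && (a == u) then b :: l else l in
  if (c == i) && (b == u) then a :: l1 else l1.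
Proof.
by move=> ltk; rewrite (take_nth (0, 0, 0)) //; case: nth => -[a b] c; apply: nbr_rcons.
Qed.

(** The bound [p <= top] is what protects existing lists when cell [top.+1] is allocated. *)
Fixpoint is_list (val lnk : nat -> nat) top p (l : seq nat) : Prop :=
  if l is x :: l' then
    [/\ 0 < p <= top, val p = x & is_list val lnk top (lnk p) l']
  else p = 0.

Lemma is_list_push val lnk top p l x y :
  is_list val lnk top p l -> is_list (setv val top.+1 x) (setv lnk top.+1 y) top.+1 p l.
Proof.
elim: l p => //= z l IH p [hp vp /IH]; rewrite !setvE.
have -> : (p == top.+1) = false by lia.
by split=> //; lia.
Qed.

Lemma is_list_cons val lnk top p l x :
  is_list val lnk top p l ->
  is_list (setv val top.+1 x) (setv lnk top.+1 p) top.+1 top.+1 (x :: l).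
Proof.
move=> h; split; rewrite ?leqnn ?setvE ?eqxx //.
exact: is_list_push.
Qed.

Definition encode (F : seq cpath) : seq nat :=
  flatten [seq p.1 :: size p.2 :: p.2 | p <- F].

Lemma decode_encode (M : memory) a F :
  (forall j, j < size (encode F) -> M (a + j) = nth 0 (encode F) j) ->
  decode_paths M a (size F) = F.
Proof.
elim: F a => //= -[c vs] F IH a; rewrite /encode /= -/(encode F) => h.
have h0 := h 0 isT; have h1 := h 1 isT; rewrite addn0 in h0; rewrite addn1 in h1.
rewrite h0 h1 /= IH.
  congr ((_, _) :: _); apply: (@eq_from_nth _ 0); rewrite size_mkseq // => j ltj.
  rewrite nth_mkseq // -addnA add2n h /= ?nth_cat ?ltj //.
  by rewrite size_cat; lia.
move=> j ltj; rewrite -!addnA add2n h /=; last by rewrite size_cat; lia.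
by rewrite nth_cat ltnNge leq_addr /= addKn.
Qed.

Lemma encode_rcons F p : encode (rcons F p) = encode F ++ p.1 :: size p.2 :: p.2.
Proof. by rewrite /encode map_rcons flatten_rcons. Qed.

Lemma mkseq_setv f k x : mkseq (setv f k x) k.+1 = rcons (mkseq f k) x.
Proof.
rewrite mkseqS setvE eqxx; congr rcons.
apply: (@eq_from_nth _ 0); rewrite !size_mkseq // => j ltj.
by rewrite !nth_mkseq // setvE; case: eqP => // ?; lia.
Qed.

(** * The program for one colour *)

Coercion EVar : nat >-> exp.
Local Notation "x ::= e" := (CSet x e) (at level 70).
Local Notation "c1 ;; c2" := (CSeq c1 c2) (at level 90, right associativity).

Local Notation vN := 0 (only parsing).
Local Notation vS := 2 (only parsing).
Local Notation vT := 3 (only parsing).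
Local Notation vM := 4 (only parsing).
Local Notation vE := 5 (only parsing).
Local Notation vJ := 6 (only parsing).
Local Notation vBase := 7 (only parsing).
Local Notation vCol := 8 (only parsing).
Local Notation vTop := 9 (only parsing).
Local Notation vU := 10 (only parsing).
Local Notation vW := 11 (only parsing).
Local Notation vX := 12 (only parsing).
Local Notation vP := 13 (only parsing).
Local Notation vHead := 14 (only parsing).
Local Notation vTail := 15 (only parsing).
Local Notation vFound := 16 (only parsing).
Local Notation vExit := 17 (only parsing).
Local Notation vDir := 18 (only parsing).
Local Notation vK := 19 (only parsing).
Local Notation vGo := 20 (only parsing).
Local Notation vBest := 21 (only parsing).
Local Notation vLen := 22 (only parsing).
Local Notation vR := 23 (only parsing).
Local Notation vA := 24 (only parsing).
Local Notation vB := 25 (only parsing).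
Local Notation vI := 26 (only parsing).

(* [aIn]: the edges, three cells each; [aOut]: the output block; [aHd], [aVal], [aLnk]:
   linked lists of neighbours, with heads indexed by [col * n + u] and 0 as null pointer;
   [aNext]: the map [nx]; [aMark], [aPar], [aVia], [aQueue]: the search; [aStart]: the
   first inner vertices of the current paths; [aDone]: the colours already treated;
   [aBase]: [col * n] for each edge. *)
Local Notation aIn := 0 (only parsing).
Local Notation aOut := 1 (only parsing).
Local Notation aHd := 2 (only parsing).
Local Notation aVal := 3 (only parsing).
Local Notation aLnk := 4 (only parsing).
Local Notation aNext := 5 (only parsing).
Local Notation aMark := 6 (only parsing).
Local Notation aPar := 7 (only parsing).
Local Notation aVia := 8 (only parsing).
Local Notation aQueue := 9 (only parsing).
Local Notation aStart := 10 (only parsing).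
Local Notation aDone := 11 (only parsing).
Local Notation aBase := 12 (only parsing).

Definition skip := vX ::= vX.
Definition dist (e1 e2 : exp) := EAdd (ESub e1 e2) (ESub e2 e1).

Lemma dist_eq0 e1 e2 r a : eval (dist e1 e2) r a = 0 <-> eval e1 r a = eval e2 r a.
Proof. by rewrite /=; lia. Qed.

Definition fill k (e : exp) :=
  vI ::= ECst 0 ;;
  CWhile (ESub vN vI) (CPut k vI e ;; vI ::= EAdd vI (ECst 1)).

(** When [w] is [s], the vertex [u] is an exit, except for [u = t], where only the direct edge has
    been found. *)
Definition visit :=
  CIf (dist vW vS)
    (vX ::= EGet aNext vW ;;
     CIf (EGet aMark vX) skip
       (CPut aMark vX (ECst 1) ;; CPut aPar vX vU ;; CPut aVia vX vW ;;
        CPut aQueue vTail vX ;; vTail ::= EAdd vTail (ECst 1)))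
    (CIf (dist vU vT) (vFound ::= ECst 1 ;; vExit ::= vU) (vDir ::= ECst 1)).

Definition scan :=
  CWhile vP (vW ::= EGet aVal vP ;; visit ;; vP ::= EGet aLnk vP).

Definition expand :=
  CWhile (ESub vTail vHead)
    (vU ::= EGet aQueue vHead ;; vHead ::= EAdd vHead (ECst 1) ;;
     vW ::= vU ;; visit ;; vP ::= EGet aHd (EAdd vBase vU) ;; scan).

Definition search :=
  fill aMark (ECst 0) ;; CPut aMark vT (ECst 1) ;; CPut aQueue (ECst 0) vT ;;
  vHead ::= ECst 0 ;; vTail ::= ECst 1 ;; vFound ::= ECst 0 ;; expand.

Definition reroute :=
  CWhile (dist vU vT) (CPut aNext (EGet aVia vU) (EGet aPar vU) ;; vU ::= EGet aPar vU).

Definition augment :=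
  CPut aStart vK vExit ;; vK ::= EAdd vK (ECst 1) ;; vU ::= vExit ;; reroute.

Definition grow :=
  vDir ::= ECst 0 ;; vK ::= ECst 0 ;; fill aNext vI ;; vGo ::= ECst 1 ;;
  CWhile vGo (search ;; CIf vFound augment (vGo ::= ECst 0)).

Ltac wps := repeat (first [apply: wp_seq | apply: wp_set | apply: wp_put]; rewrite /=).

Lemma fill_ok k e (g : nat -> nat) z r a :
  (forall r a, eval e r a = g (r vI)) ->
  wp (fill k e) (fun S' => (forall v, v < r vN -> arr S' k v = g v) /\
    clock S' <= z + 3 * r vN + 2) (Store z r a).
Proof.
move=> eE; wps.
pose inv j (S' : store) := [/\ j + var S' vI = r vN, 
  forall v, v < var S' vI -> arr S' k v = g v & clock S' <= z + 3 * var S' vI + 1].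
apply: (wp_while (I := inv) (k0 := r vN)).
- by split=> //=; rewrite ?addn0 //; lia.
- move=> j z' r' a' [/(_ 0 isT)/= rN _] [/= ej fj cj] /= en0; wps.
  rewrite eE; exists j.-1; first lia.
  split=> /=; [lia | | lia].
  move=> v lv; rewrite setaE eqxx setvE; case: eqP => [-> //|ne]; apply: fj; lia.
- move=> j z' r' a' [/(_ 0 isT)/= rN _] [/= ej fj cj] /= en0; split=> /=; last lia.
  by move=> v lv; apply: fj; lia.
Qed.

(** * Correctness and cost of one search *)

Section Search.
Variables (n s t : nat) (nb : nat -> seq nat) (base top : nat).
Hypotheses (s_neq_t : s != t) (lt_sn : s < n) (lt_tn : t < n).
Hypothesis nb_lt : forall u v, v \in nb u -> v < n.
Hypothesis nb_sym : forall u v, (v \in nb u) = (u \in nb v).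

Definition context (r : nat -> nat) (a : nat -> nat -> nat) :=
  [/\ r vN = n, r vS = s, r vT = t, r vBase = base &
      forall u, u < n -> is_list (a aVal) (a aLnk) top (a aHd (base + u)) (nb u)].

Lemma context_frame c z r a z' r' a' :
  frame c (Store z r a) (Store z' r' a') -> context r a ->
  all (fun x => x \notin vmods c) [:: vN; vS; vT; vBase] ->
  all (fun x => x \notin amods c) [:: aVal; aLnk; aHd] -> context r' a'.
Proof.
move=> [fv fa] [h0 h2 h3 h7 hl] /and5P[v0 v2 v3 v7 _] /and4P[a3 a4 a2 _].
move: (fv 0 v0) (fv 2 v2) (fv 3 v3) (fv 7 v7) (fa 2 a2) (fa 3 a3) (fa 4 a4) => /=.
by rewrite /context => -> -> -> -> -> -> ->.
Qed.

Definition queue (r : nat -> nat) (a : nat -> nat -> nat) := mkseq (a aQueue) (r vTail).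

(** For the flags [vFound] and [vDir] this records soundness only; completeness is accumulated pair
    by pair through [handled]. *)
Definition bfs nx (r : nat -> nat) (a : nat -> nat -> nat) :=
  [/\ search_tree n s t nb nx (a aPar) (a aVia) (queue r a),
      forall x, x < n -> (a aMark x != 0) = (x \in queue r a),
      r vFound <> 0 -> [/\ r vExit \in queue r a, r vExit != t & s \in nb (r vExit)] &
      r vDir = 0 \/ r vDir = 1 /\ s \in nb t].

Lemma bfs_tree nx r a : bfs nx r a ->
  search_tree n s t nb nx (a aPar) (a aVia) (queue r a).
Proof. by case. Qed.

(** What visiting [w] from [u] must achieve. Once it holds for all reached [u] and [vFound] is 0, it
    provides [closed] and [no_exit] for the cut. *)
Definition handled (nx : nat -> nat) (r : nat -> nat) (a : nat -> nat -> nat) u w :=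
  if w == s then if u == t then r vDir = 1 else r vFound <> 0
  else nx w \in queue r a.

(** Within a search the queue only grows at its end and flags are never cleared, so pairs once
    handled remain handled. *)
Definition extends (r r' : nat -> nat) (a a' : nat -> nat -> nat) :=
  [/\ r vTail <= r' vTail, forall j, j < r vTail -> a' aQueue j = a aQueue j,
      r vDir = 1 -> r' vDir = 1 & r vFound <> 0 -> r' vFound <> 0].

Lemma extends_trans r1 r2 r3 a1 a2 a3 :
  extends r1 r2 a1 a2 -> extends r2 r3 a2 a3 -> extends r1 r3 a1 a3.
Proof.
move=> [t1 q1 d1 f1] [t2 q2 d2 f2]; split; [lia | | auto | auto].
by move=> j lj; rewrite q2 ?q1 //; lia.
Qed.

Lemma extends_queue r r' a a' : extends r r' a a' -> {subset queue r a <= queue r' a'}.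
Proof.
move=> [t1 q1 _ _] x /mapP[j]; rewrite mem_iota add0n => /= lj ->.
by rewrite -q1 //; apply: map_f; rewrite mem_iota add0n; lia.
Qed.

Lemma handled_extends nx r r' a a' u w :
  extends r r' a a' -> handled nx r a u w -> handled nx r' a' u w.
Proof.
move=> ex; have sub := extends_queue ex; case: ex => _ _ d f.
by rewrite /handled; case: ifP => _; [case: ifP => _ |]; auto.
Qed.

Variable nx : nat -> nat.
Hypothesis nx_inner : forall v, inner n s t v -> nx v = t \/ inner n s t (nx v).
(** This makes visiting [w = t] harmless: it leads back to [t], which is marked from the outset. *)
Hypothesis nx_t : nx t = t.

Lemma bfs_size r a : bfs nx r a -> r vTail <= n.
Proof.
case=> T _ _ _; rewrite -[r vTail](size_mkseq (a aQueue)) -[n](size_iota 0).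
apply: uniq_leq_size => [|x xQ]; first by case: T.
rewrite mem_iota add0n; have [->//|xt] := eqVneq x t.
by case/andP: (tree_inner T xQ xt).
Qed.

(** The 8 ticks are the two tests and six assignments of the longest branch. *)
Lemma visit_ok z r a u w :
  context r a -> a aNext = nx -> bfs nx r a -> r vU = u -> r vW = w ->
  u \in queue r a -> w \in u :: nb u ->
  wp visit (fun S' => [/\ bfs nx (var S') (arr S'), handled nx (var S') (arr S') u w,
    extends r (var S') a (arr S') & clock S' <= z + 8]) (Store z r a).
Proof.
move=> [rN rS rT _ _] aN [T mk fd dr] rU rW uQ wu.
have ltu : u < n.
  have [->//|ut] := eqVneq u t; by case/andP: (tree_inner T uQ ut).
have ltw : w < n by move: wu; rewrite inE => /orP[/eqP -> //|/nb_lt].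
apply: wp_if => [/= dws | /dist_eq0 /= ews]; last first.
  have ews' : w = s by lia.
  apply: wp_if => [/= dut | /dist_eq0 /= eut]; wps.
    have ut : u <> t by lia.
    split=> /=; last lia.
    - split=> //= _; rewrite rU; split=> //; first exact/eqP.
      move: wu; rewrite ews' inE => /orP[/eqP su|//].
      by have /and3P[_] := tree_inner T uQ (introN eqP ut); rewrite su eqxx.
    - by rewrite /handled ews' eqxx (introF eqP ut).
    - by [].
  have ut : u = t by lia.
  split=> /=; last lia.
  - split=> //=; right; split=> //.
    move: wu; rewrite ews' ut inE => /orP[/eqP st|//].
    by move: s_neq_t; rewrite st eqxx.
  - by rewrite /handled ews' eqxx ut eqxx.
  - by [].
have nws : w <> s by lia.
wps; rewrite aN rW.
have ltx : nx w < n.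
  have [->|wt] := eqVneq w t; first by rewrite nx_t.
  have iw : inner n s t w by rewrite /inner ltw wt andbT; apply/eqP.
  by case: (nx_inner iw) => [->//|/andP[]].
apply: wp_if => /= mkx; wps.
  split=> /=; last lia.
  - by split.
  - by rewrite /handled (introF eqP nws) -[queue _ _]/(queue r a) -mk //; apply/eqP.
  - by [].
have xQ : nx w \notin queue r a by rewrite -mk // mkx.
have wt : w != t.
  apply: contra xQ => /eqP ->; rewrite nx_t -{1}(tree_root T); apply: mem_nth; exact: tree_gt0 T.
have iw : inner n s t w by rewrite /inner ltw wt andbT; apply/eqP.
have ix : inner n s t (nx w).
  case: (nx_inner iw) => // e; rewrite e -{1}(tree_root T) mem_nth // in xQ; exact: tree_gt0 T.
have qE r1 a1 : r1 vTail = r vTail + 1 -> a1 aQueue = setv (a aQueue) (r vTail) (nx w) ->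
    queue r1 a1 = rcons (queue r a) (nx w).
  by move=> e1 e2; rewrite /queue e1 e2 addn1 mkseq_setv.
split=> /=; last lia.
- split; rewrite 1?qE //=.
  + by rewrite rU rW; apply: search_tree_rcons.
  + move=> x lx; rewrite mem_rcons inE -mk // setvE; by case: (x == nx w).
  + move=> f0; have [h1 h2 h3] := fd f0; split=> //.
    by rewrite mem_rcons inE h1 orbT.
- by rewrite /handled (introF eqP nws) qE //= mem_rcons mem_head.
- split=> //=; first lia.
  by move=> j lj; rewrite setvE; case: eqP => // ?; lia.
Qed.

Lemma scan_ok z r a u l :
  context r a -> a aNext = nx -> bfs nx r a -> r vU = u -> u \in queue r a ->
  is_list (a aVal) (a aLnk) top (r vP) l -> {subset l <= nb u} ->
  wp scan (fun S' => [/\ bfs nx (var S') (arr S'),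
    forall w, w \in l -> handled nx (var S') (arr S') u w,
    extends r (var S') a (arr S') & clock S' <= z + 11 * size l + 1]) (Store z r a).
Proof.
move=> ctx aN b rU uQ lP lnb.
pose inv k (S' : store) := exists l1 l2, [/\ l = l1 ++ l2, size l2 = k,
  is_list (a aVal) (a aLnk) top (var S' vP) l2, bfs nx (var S') (arr S') &
  [/\ forall w, w \in l1 -> handled nx (var S') (arr S') u w,
     extends r (var S') a (arr S') & clock S' <= z + 11 * size l1]].
apply: (wp_while (I := inv) (k0 := size l)).
- by exists [::], l; split=> //=; split=> //; rewrite muln0 addn0.
- move=> k z' r' a' fr [l1 [l2 [lE kE lP' b' [/= hl ex cl]]]] /= p0.
  have ctx' := context_frame fr ctx isT isT.
  have [fv fa] := fr.
  have rU' : r' vU = u by rewrite -rU; apply: (fv 10 isT).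
  have aN' : a' aNext = nx by rewrite -aN; apply: (fa 5 isT).
  have aV' : a' aVal = a aVal by apply: (fa 3 isT).
  have aL' : a' aLnk = a aLnk by apply: (fa 4 isT).
  case: l2 lE kE lP' => [|w l2] lE kE /=; first by move=> e; rewrite e in p0.
  move=> [pb pv lP'].
  wps; rewrite aV' pv.
  have uQ' := extends_queue ex uQ.
  have wu : w \in u :: nb u by rewrite inE lnb ?orbT // lE mem_cat mem_head orbT.
  apply: (wp_conseq (visit_ok _ (r := setv r' vW w) ctx' aN' b' rU' (erefl w) uQ' wu)).
  move=> [z2 r2 a2] [fv2 fa2] /= [b2 h2 ex2 c2]; wps.
  have rP2 : r2 vP = r' vP by apply: (fv2 13 isT).
  have aL2 : a2 aLnk = a aLnk by rewrite -aL'; apply: (fa2 4 isT).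
  exists (size l2); first by rewrite -kE.
  exists (rcons l1 w), l2; split=> //=.
  + by rewrite cat_rcons.
  + by rewrite aL2 rP2.
  split=> //=.
  + move=> w'; rewrite mem_rcons inE => /orP[/eqP -> //|/hl].
    exact: handled_extends.
  + exact: extends_trans ex ex2.
  + by rewrite size_rcons; move: cl => /=; lia.
- move=> k z' r' a' fr [l1 [l2 [lE kE lP' b' [/= hl ex cl]]]] /= p0.
  case: l2 lE kE lP' => [|w l2] lE kE /=; last by case; lia.
  move=> _; rewrite cats0 in lE; split=> //=; first by rewrite lE.
  by rewrite lE; move: cl => /=; lia.
Qed.

Variable deg : nat.
Hypothesis sum_deg : forall Q, uniq Q -> \sum_(u <- Q) size (nb u) <= deg.

Definition searched r a :=
  forall u w, u \in queue r a -> w \in u :: nb u -> handled nx r a u w.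

Lemma expand_ok z r a :
  context r a -> a aNext = nx -> bfs nx r a -> r vHead = 0 ->
  wp expand (fun S' => [/\ bfs nx (var S') (arr S'), searched (var S') (arr S') &
    clock S' <= z + 20 * n + 11 * deg + 1]) (Store z r a).
Proof.
move=> ctx aN b r0.
pose inv k (S' : store) := [/\ k + var S' vHead = n, var S' vHead <= var S' vTail,
  bfs nx (var S') (arr S'),
  forall j w, j < var S' vHead -> w \in arr S' aQueue j :: nb (arr S' aQueue j) ->
    handled nx (var S') (arr S') (arr S' aQueue j) w &
  clock S' <= z + 20 * var S' vHead +
    11 * \sum_(u <- mkseq (arr S' aQueue) (var S' vHead)) size (nb u)].
apply: (wp_while (I := inv) (k0 := n)).
- by split=> //=; rewrite r0 ?muln0 ?big_nil ?addn0.
- move=> k z' r' a' fr [/= kE ht b' hj cl] /= th.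
  have ctx' := context_frame fr ctx isT isT.
  have [_ fa] := fr; have aN' : a' aNext = nx by rewrite -aN; apply: (fa 5 isT).
  have tn := bfs_size b'.
  set u := a' aQueue (r' vHead).
  have uQ : u \in queue r' a' by apply: map_f; rewrite mem_iota add0n; lia.
  have ltu : u < n.
    have [->//|ut] := eqVneq u t.
    by case/andP: (tree_inner (bfs_tree b') uQ ut).
  wps.
  apply: (wp_conseq (visit_ok _ (r := setv (setv (setv r' vU u) vHead (r' vHead + 1)) vW u)
    ctx' aN' b' (erefl u) (erefl u) uQ (mem_head _ _))).
  move=> [z2 r2 a2] fr2 /= [b2 h2 ex2 c2]; wps.
  have ctx2 : context r2 a2 by apply: (context_frame fr2 _ isT isT); case: ctx'.
  have [fv2 fa2] := fr2.
  have rU2 : r2 vU = u by apply: (fv2 10 isT).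
  have rH2 : r2 vHead = r' vHead + 1 by apply: (fv2 14 isT).
  have aN2 : a2 aNext = nx by rewrite -aN'; apply: (fa2 5 isT).
  have lP : is_list (a2 aVal) (a2 aLnk) top (a2 aHd (r2 vBase + r2 vU)) (nb u).
    by case: ctx2 => _ _ _ -> hl; rewrite rU2; apply: hl.
  apply: (wp_conseq (scan_ok _ (r := setv r2 vP (a2 aHd (r2 vBase + r2 vU)))
    ctx2 aN2 b2 rU2 (extends_queue ex2 uQ) lP (fun=> id))).
  move=> [z3 r3 a3] [fv3 fa3] /= [b3 h3 ex3 c3].
  have rH3 : r3 vHead = r' vHead + 1 by rewrite -rH2; apply: (fv3 14 isT).
  have ex : extends r' r3 a' a3 by apply: extends_trans ex2 ex3.
  have qE j : j <= r' vHead -> a3 aQueue j = a' aQueue j.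
    by move=> lj; case: ex => _ q _ _; apply: q; lia.
  have [le3 _ _ _] := ex.
  exists k.-1; first by lia.
  split=> /=; rewrite ?rH3.
  + lia.
  + lia.
  + by [].
  + move=> j w; rewrite addn1 ltnS => lj; rewrite qE //.
    move: lj; rewrite leq_eqVlt => /orP[/eqP -> | lj]; last first.
      by move=> wj; apply: handled_extends ex _; apply: hj.
    rewrite -/u inE => /orP[/eqP ->|]; last exact: h3.
    by apply: handled_extends ex3 _.
  + have -> : mkseq (a3 aQueue) (r' vHead + 1) = rcons (mkseq (a' aQueue) (r' vHead)) u.
      rewrite addn1 mkseqS qE //; congr rcons.
      apply: (@eq_from_nth _ 0); rewrite !size_mkseq // => j lj.
      by rewrite !nth_mkseq // qE //; lia.
    by rewrite -cats1 big_cat big_seq1 /=; lia.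
- move=> k z' r' a' fr [/= kE ht b' hj cl] /= th.
  have hE : r' vHead = r' vTail by lia.
  split=> //=.
  + move=> u w /mapP[j]; rewrite mem_iota add0n => /= lj -> wj.
    by apply: hj => //; rewrite hE.
  + have : \sum_(u <- mkseq (a' aQueue) (r' vHead)) size (nb u) <= deg.
      by rewrite hE; apply: sum_deg; apply: tree_uniq (bfs_tree b').
    have := bfs_size b'; move: (\sum_(u <- _) _) cl; lia.
Qed.

Lemma search_ok z r a :
  context r a -> a aNext = nx -> r vDir = 0 \/ r vDir = 1 /\ s \in nb t ->
  wp search (fun S' => [/\ bfs nx (var S') (arr S'), searched (var S') (arr S') &
    clock S' <= z + 23 * n + 11 * deg + 8]) (Store z r a).
Proof.
move=> ctx aN dr; have [rN rS rT rB _] := ctx.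
apply: wp_seq; apply: (wp_conseq (@fill_ok aMark (ECst 0) (fun=> 0) z r a (fun _ _ => erefl))).
move=> [z1 r1 a1] fr1 /= [mk c1]; wps.
have ctx1 : context r1 a1 by apply: (context_frame fr1 ctx isT isT).
have [fv1 fa1] := fr1; have rT1 : r1 vT = t by case: ctx1.
have aN1 : a1 aNext = nx by rewrite -aN; apply: (fa1 5 isT).
set r2 := setv (setv (setv r1 vHead 0) vTail 1) vFound 0.
set a2 := seta (seta a1 aMark (r1 vT) 1) aQueue 0 (r1 vT).
have b2 : bfs nx r2 a2.
  have qE : queue r2 a2 = [:: t] by rewrite /queue /mkseq /r2 /a2 /= rT1.
  split; rewrite ?qE //=.
  + exact: search_tree_root.
  + move=> x lx; rewrite /a2 /= rT1 setvE inE; have [//|_] := eqVneq x t.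
    by rewrite mk ?rN.
  + by rewrite /r2 /=; have -> : r1 vDir = r vDir by apply: (fv1 18 isT).
apply: (wp_conseq (expand_ok _ (r := r2) (a := a2) ctx1 aN1 b2 (erefl 0))).
move=> [z3 r3 a3] _ /= [b3 s3 c3]; split=> //.
by move: c1 c3; rewrite rN /=; lia.
Qed.

End Search.

(** The number of nodes precedes the nodes in the encoding but is known only after the walk, so cell
    [vLen + 1] is filled after them. *)
Definition write_traces :=
  CWhile (ESub vK vJ)
    (CPut aOut vLen vCol ;; CPut aOut (EAdd vLen (ECst 2)) vS ;;
     vR ::= EAdd vLen (ECst 3) ;; vX ::= EGet aStart vJ ;;
     CWhile (dist vX vT)
       (CPut aOut vR vX ;; vR ::= EAdd vR (ECst 1) ;; vX ::= EGet aNext vX) ;;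
     CPut aOut vR vT ;;
     CPut aOut (EAdd vLen (ECst 1)) (ESub vR (EAdd vLen (ECst 1))) ;;
     vLen ::= EAdd vR (ECst 1) ;; vJ ::= EAdd vJ (ECst 1)).

Definition output :=
  CPut aOut (ECst 0) (EAdd vK vDir) ;; vLen ::= ECst 1 ;;
  CIf vDir
    (CPut aOut vLen vCol ;; CPut aOut (EAdd vLen (ECst 1)) (ECst 2) ;;
     CPut aOut (EAdd vLen (ECst 2)) vS ;; CPut aOut (EAdd vLen (ECst 3)) vT ;;
     vLen ::= EAdd vLen (ECst 4))
    skip ;;
  vJ ::= ECst 0 ;; write_traces.

(** Cell 0 of the block is reserved for the number of paths, hence the shift by one; [len] is the
    first free cell. *)
Definition written (a : nat -> nat -> nat) len F :=
  len = (size (encode F)).+1 /\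
  forall j, j < size (encode F) -> a aOut j.+1 = nth 0 (encode F) j.

Lemma written_nil a : written a 1 [::].
Proof. by []. Qed.

Lemma written_rcons a a' len F p :
  written a len F -> (forall j, 0 < j < len -> a' aOut j = a aOut j) ->
  a' aOut len = p.1 -> a' aOut len.+1 = size p.2 ->
  (forall j, j < size p.2 -> a' aOut (len + 2 + j) = nth 0 p.2 j) ->
  written a' (len + 2 + size p.2) (rcons F p).
Proof.
move=> [lE wF] same e0 e1 e2; split; rewrite encode_rcons size_cat /=; first lia.
move=> j lj; rewrite nth_cat; case: ltnP => [lt|ge]; first by rewrite same ?wF //; lia.
have [d jE] : exists d, j = size (encode F) + d by exists (j - size (encode F)); lia.
rewrite jE addKn; case: d jE => [|[|d]] jE /=.
- by rewrite addn0 -lE.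
- by rewrite addn1 -lE.
- by rewrite -e2; [congr (a' _ _) | ]; lia.
Qed.

(** * A maximum family in one colour, and its output *)

Section Color.
Variables (n s t : nat) (nb : nat -> seq nat) (base top : nat).
Hypotheses (s_neq_t : s != t) (lt_sn : s < n) (lt_tn : t < n).
Hypothesis nb_lt : forall u v, v \in nb u -> v < n.
Hypothesis nb_sym : forall u v, (v \in nb u) = (u \in nb v).
Variable deg : nat.
Hypothesis sum_deg : forall Q, uniq Q -> \sum_(u <- Q) size (nb u) <= deg.

Lemma reroute_ok nx z r a Q S j :
  search_tree n s t nb nx (a aPar) (a aVia) Q ->
  augmenting n s t nb (a aVia) Q S (a aNext) (r vU) j ->
  r vT = t -> a aNext t = t ->
  wp reroute (fun S' => [/\ linking n s t nb (arr S' aNext) S, arr S' aNext t = t &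
    clock S' <= z + 3 * j + 1]) (Store z r a).
Proof.
move=> T A rT at_.
pose inv k (S' : store) :=
  [/\ augmenting n s t nb (a aVia) Q S (arr S' aNext) (var S' vU) k,
      arr S' aNext t = t & clock S' + 3 * k <= z + 3 * j].
apply: (wp_while (I := inv) (k0 := j)) => //.
- move=> k z' r' a' [fv fa] [/= Ak at' cl] /= du; wps.
  have rT' : r' vT = t by rewrite -rT; apply: (fv 3 isT).
  have aP : a' aPar = a aPar by apply: (fa 7 isT).
  have aV : a' aVia = a aVia by apply: (fa 8 isT).
  have ut : r' vU <> t by lia.
  have [k' ltk Ak'] := augmenting_step s_neq_t lt_sn lt_tn nb_sym T Ak ut.
  exists k' => //; split=> /=; rewrite ?aP ?aV //; last lia.
  have uQ : r' vU \in Q by case: Ak => lk -> _ _; apply: mem_nth.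
  rewrite setvE; case: eqP => // e.
  by have /and3P[_ _] := tree_via T uQ (introN eqP ut); rewrite e eqxx.
- move=> k z' r' a' [fv fa] [/= Ak at' cl] /= du.
  have rT' : r' vT = t by rewrite -rT; apply: (fv 3 isT).
  split=> //=; last lia.
  have ut : r' vU = t by lia.
  by apply: (@augmenting_end _ _ _ _ (a aVia) Q _ _ k); rewrite ut in Ak.
Qed.

Lemma augment_ok z r a :
  linking n s t nb (a aNext) (mkseq (a aStart) (r vK)) ->
  bfs n s t nb (a aNext) r a -> r vFound <> 0 -> r vT = t -> a aNext t = t ->
  wp augment (fun S' =>
    [/\ linking n s t nb (arr S' aNext) (mkseq (arr S' aStart) (var S' vK)),
        arr S' aNext t = t, var S' vK = (r vK).+1 & clock S' <= z + 3 * n + 4])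
    (Store z r a).
Proof.
move=> L b f0 rT at_; have [T _ /(_ f0)[eQ et es] _] := b.
have A := augmenting_start L T eQ et es.
have lej : index (r vExit) (queue r a) < n.
  apply: leq_trans (bfs_size lt_tn b); rewrite -[X in _ < X](size_mkseq (a aQueue)).
  by rewrite index_mem.
wps; set r2 := setv _ vU _; set a2 := seta _ _ _ _.
apply: (wp_conseq (@reroute_ok (a aNext) _ r2 a2 (queue r a)
  (rcons (mkseq (a aStart) (r vK)) (r vExit)) (index (r vExit) (queue r a)) T A rT at_)).
move=> [z3 r3 a3] [fv fa] /= [L3 at3 c3].
have rK : r3 vK = r vK + 1 by apply: (fv 19 isT).
rewrite addn1 in rK.
have aS : a3 aStart = setv (a aStart) (r vK) (r vExit) by apply: (fa 10 isT).
by split=> //; [rewrite rK aS mkseq_setv | lia].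
Qed.

Definition grown (r : nat -> nat) (a : nat -> nat -> nat) :=
  [/\ linking n s t nb (a aNext) (mkseq (a aStart) (r vK)), r vDir = (s \in nb t) &
      forall E i c F, (forall u v, adj E i u v = (v \in nb u)) ->
        cdp_family c E s t F -> all (fun p => p.1 == i) F -> size F <= r vK + r vDir].

Lemma grow_ok z r a :
  context n s t nb base top r a ->
  wp grow (fun S' => grown (var S') (arr S') /\
    clock S' <= z + 3 * n + 8 + (var S' vK).+1 * (26 * n + 11 * deg + 20))
    (Store z r a).
Proof.
move=> ctx; have [rN _ _ _ _] := ctx.
do 2![apply: wp_seq; apply: wp_set; rewrite /=]; apply: wp_seq.
apply: (wp_conseq (@fill_ok aNext vI id _ _ _ (fun _ _ => erefl))).
move=> [z1 r1 a1] fr1 /= [fl c1]; wps; rewrite rN in fl c1.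
have ctx1 : context n s t nb base top r1 a1 by apply: (context_frame fr1 ctx isT isT).
have rD1 : r1 vDir = 0 by case: fr1 => fv _; apply: (fv 18 isT).
have rK1 : r1 vK = 0 by case: fr1 => fv _; apply: (fv 19 isT).
(* One search costs [23 * n + 11 * deg] and one rerouting [3 * n], up to constants. *)
set T := 26 * n + 11 * deg + 20.
(* The variant is [(n - vK).+1] while searches succeed, which decreases because [linking_size]
   bounds [vK] by [n]; it becomes 0 after the failing search. *)
pose inv k (S' : store) :=
  [/\ linking n s t nb (arr S' aNext) (mkseq (arr S' aStart) (var S' vK)),
      arr S' aNext t = t, var S' vDir = 0 \/ var S' vDir = 1 /\ s \in nb t &
      if var S' vGo == 0 then grown (var S') (arr S') /\
        clock S' <= z + 3 * n + 7 + (var S' vK).+1 * T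
      else k = (n - var S' vK).+1 /\ clock S' <= z + 3 * n + 7 + var S' vK * T].
apply: (wp_while (I := inv) (k0 := n.+1)).
- split=> /=.
  + by rewrite rK1; apply: linking_id.
  + exact: fl.
  + by left.
  + by rewrite rK1 subn0; split=> //; lia.
- move=> k z' r' a' fr [/= L at_ dr gk] /= g0.
  rewrite (introF eqP g0) in gk; have [kE cl] := gk.
  have ctx' : context n s t nb base top r' a' by apply: (context_frame fr ctx1 isT isT).
  apply: wp_seq.
  apply: (wp_conseq (search_ok s_neq_t lt_sn lt_tn nb_lt (link_step L) at_ sum_deg
    z'.+1 ctx' (erefl _) dr)).
  move=> [z2 r2 a2] fr2 /= [b2 s2 c2].
  have ctx2 : context n s t nb base top r2 a2 by apply: (context_frame fr2 ctx' isT isT).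
  have [fv2 fa2] := fr2.
  have rK2 : r2 vK = r' vK by apply: (fv2 19 isT).
  have rG2 : r2 vGo = r' vGo by apply: (fv2 20 isT).
  have aN2 : a2 aNext = a' aNext by apply: (fa2 5 isT).
  have aS2 : a2 aStart = a' aStart by apply: (fa2 10 isT).
  rewrite -aN2 in L at_ b2 s2; rewrite -aS2 -rK2 in L; rewrite -rK2 in kE cl.
  have rT2 : r2 vT = t by case: ctx2.
  apply: wp_if => /= f2.
    apply: (wp_conseq (augment_ok _ L b2 f2 rT2 at_)).
    move=> [z3 r3 a3] [fv3 fa3] /= [L3 at3 rK3 c3].
    have rG3 : r3 vGo = r2 vGo by apply: (fv3 20 isT).
    have rD3 : r3 vDir = r2 vDir by apply: (fv3 18 isT).
    have := linking_size L3; rewrite size_mkseq rK3 => leK.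
    exists (n - r3 vK).+1; first by rewrite kE rK3; lia.
    split=> //=; first by rewrite rD3; case: b2.
    rewrite rG3 rG2 (introF eqP g0); split=> //.
    by rewrite rK3 mulSn /T; rewrite /T in cl; lia.
  wps; exists 0; first by rewrite kE.
  have [T2 _ _ dr2] := b2.
  have tQ : t \in queue r2 a2.
    by rewrite -{1}(tree_root T2); apply: mem_nth; apply: tree_gt0 T2.
  (* [t] is itself in the queue, so a direct edge cannot escape a completed search. *)
  have dirE : r2 vDir = (s \in nb t).
    case: dr2 => [d0|[-> ->] //]; case st: (s \in nb t) => //.
    have := s2 t s tQ; rewrite inE st orbT => /(_ isT).
    by rewrite /handled !eqxx d0.
  split=> //=; split; last by rewrite mulSn /T; rewrite /T in cl; lia.
  split=> //= E i c F adjE cF aF; rewrite dirE.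
  rewrite -[X in _ <= X + _](size_mkseq (a2 aStart)).
  apply: (family_bound s_neq_t lt_sn lt_tn nb_lt nb_sym L T2 _ _ adjE cF aF).
    move=> u w uQ wu ws; have := s2 u w uQ wu.
    by rewrite /handled (introF eqP ws).
  move=> u uQ ut; apply/negP => su; have := s2 u s uQ; rewrite inE su orbT => /(_ isT).
  by rewrite /handled eqxx (negPf ut).
- move=> k z' r' a' fr [/= L at_ dr gk] /= g0.
  by rewrite g0 eqxx in gk; case: gk => G cl; split=> //=; lia.
Qed.

Section Output.
Variables (nx : nat -> nat) (S : seq nat) (col : nat).
Hypothesis L : linking n s t nb nx S.

Definition traces S' : seq cpath := [seq (col, trace n s t nx w) | w <- S'].

Lemma write_traces_ok z r a F :
  r vS = s -> r vT = t -> r vCol = col -> r vK = size S -> r vJ = 0 ->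
  a aNext = nx -> (forall j, j < size S -> a aStart j = nth 0 S j) ->
  written a (r vLen) F ->
  wp write_traces (fun S' => [/\ written (arr S') (var S' vLen) (F ++ traces S),
     arr S' aOut 0 = a aOut 0, clock S' <= z + size S * (4 * n + 11) + 1 &
     var S' vLen <= r vLen + size S * (n + 4)]) (Store z r a).
Proof.
move=> rS rT rC rK rJ aN aS wF.
pose inv k (S' : store) := [/\ k + var S' vJ = size S,
  written (arr S') (var S' vLen) (F ++ traces (take (var S' vJ) S)),
  arr S' aOut 0 = a aOut 0, clock S' <= z + var S' vJ * (4 * n + 11) &
  var S' vLen <= r vLen + var S' vJ * (n + 4)].
apply: (wp_while (I := inv) (k0 := size S)).
- split=> //=; rewrite rJ ?addn0 ?take0 ?cats0 //.
- move=> k z' r' a' [fv fa] [/= kE wk o0 cl le] /= kj.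
  have rK' : r' vK = size S by rewrite -rK; apply: (fv 19 isT).
  have rS' : r' vS = s by rewrite -rS; apply: (fv 2 isT).
  have rT' : r' vT = t by rewrite -rT; apply: (fv 3 isT).
  have rC' : r' vCol = col by rewrite -rC; apply: (fv 8 isT).
  have aN' : a' aNext = nx by rewrite -aN; apply: (fa 5 isT).
  have aS' : a' aStart = a aStart by apply: (fa 10 isT).
  have ltJ : r' vJ < size S by lia.
  pose w := nth 0 S (r' vJ).
  have wS : w \in S by apply: mem_nth.
  have [len on wt] := trace_end s_neq_t lt_sn lt_tn L wS.
  wps; rewrite rC' rS' aS' aS // -/w.
  set p := r' vLen; have p0 : 0 < p by rewrite /p; case: wk => ->.
  set a1 := seta _ _ _ _.
  set r1 := setv _ vX w.
  pose inv1 i (S' : store) := exists j, [/\ i + j = trace_len n t nx w,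
    var S' vX = iter j nx w, var S' vR = p + 3 + j,
    forall y, y < p + 3 -> arr S' aOut y = a1 aOut y &
    (forall l, l < j -> arr S' aOut (p + 3 + l) = iter l nx w) /\
    clock S' <= z' + 5 + 4 * j].
  apply: (wp_while (I := inv1) (k0 := trace_len n t nx w)).
  + by exists 0; split=> //=; rewrite ?addn0 //; split=> //; lia.
  + move=> i z2 r2 a2 [fv2 fa2] [j [/= ij xE RE lo [hi c2]]] /= dx.
    have rT2 : r2 vT = t by rewrite -rT'; apply: (fv2 3 isT).
    have aN2 : a2 aNext = nx by rewrite -aN'; apply: (fa2 5 isT).
    have i0 : 0 < i.
      rewrite lt0n; apply/eqP => i0; rewrite i0 add0n in ij.
      by apply: dx; rewrite rT2 xE ij wt; lia.
    wps; exists i.-1; first lia.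
    exists j.+1; split=> /=.
    * lia.
    * by rewrite aN2 xE.
    * by rewrite RE; lia.
    * by move=> y ly; rewrite RE setvE; case: eqP => [?|_]; [lia | apply: lo].
    * split; last lia.
      move=> l; rewrite ltnS leq_eqVlt RE setvE => /orP[/eqP -> | lj].
        by rewrite eqxx xE.
      by rewrite eqn_add2l; case: eqP => [?|_]; [lia | apply: hi].
  move=> i z2 r2 a2 [fv2 fa2] [j [/= ij xE RE lo [hi c2]]] /= dx.
  have rT2 : r2 vT = t by rewrite -rT'; apply: (fv2 3 isT).
  have rJ2 : r2 vJ = r' vJ by apply: (fv2 6 isT).
  have rL2 : r2 vLen = p by apply: (fv2 22 isT).
  have jE : j = trace_len n t nx w.
    have [lt|ge] := ltnP j (trace_len n t nx w); last lia.
    by have /and3P[_ _ /eqP[]] := on j lt; lia.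
  wps; exists k.-1; first lia.
  have szT : size (trace n s t nx w) = j + 2.
    by rewrite /= size_rcons size_mkseq jE addn2.
  split=> /=; rewrite ?rJ2.
  + lia.
  + rewrite (addn1 (r' vJ)) (take_nth 0) // /traces map_rcons -rcons_cat -/w RE rL2 rT2.
    have -> : p + 3 + j + 1 = p + 2 + size (trace n s t nx w) by rewrite szT; lia.
    apply: (written_rcons (a := a') (len := p) (p := (col, trace n s t nx w))) => //.
    * move=> y ly; rewrite /= !setvE; do 2![case: eqP => [?|_]; first lia].
      by rewrite lo ?/a1 /= ?setvE; [do 2![case: eqP => [?|_]; first lia] | lia].
    * rewrite /= !setvE; do 2![case: eqP => [?|_]; first lia].
      by rewrite lo ?/a1 /= ?setvE; [case: eqP => [?|_]; [lia | rewrite eqxx] | lia].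
    * rewrite [size _]szT /= setvE addn1 eqxx; lia.
    * move=> l; rewrite [size _]szT => ll /=; rewrite setvE.
      case: eqP => [?|_]; first lia.
      case: l ll => [|l] ll /=.
        rewrite setvE; case: eqP => [?|_]; first lia.
        by rewrite addn0 lo ?/a1 /= ?setvE ?eqxx //; lia.
      rewrite nth_rcons size_mkseq -jE setvE.
      have [lt|gt|eq] := ltngtP l j.
      - case: eqP => [?|_]; first lia.
        by rewrite nth_mkseq //= -hi //; congr (a2 _ _); lia.
      - lia.
      - by case: eqP => // ?; lia.
  + rewrite !setvE /=; do 2![case: eqP => [?|_]; first lia].
    by rewrite lo ?/a1 /= ?setvE; [do 2![case: eqP => [?|_]; first lia] | lia].
  + by rewrite (addn1 (r' vJ)) mulSn; lia.
  + by rewrite (addn1 (r' vJ)) mulSn RE; lia.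
- move=> k z' r' a' [fv fa] [/= kE wk o0 cl le] /= kj.
  have rK' : r' vK = size S by rewrite -rK; apply: (fv 19 isT).
  have JE : r' vJ = size S by lia.
  by rewrite JE take_size in wk cl le; split=> //=; lia.
Qed.

Definition link_family : seq cpath :=
  (if s \in nb t then [:: (col, [:: s; t])] else [::]) ++ traces S.

Lemma size_link_family : size link_family = size S + (s \in nb t).
Proof. by rewrite size_cat size_map addnC; case: ifP. Qed.

Lemma output_ok z r a :
  r vS = s -> r vT = t -> r vCol = col -> r vK = size S -> r vDir = (s \in nb t) ->
  a aNext = nx -> (forall j, j < size S -> a aStart j = nth 0 S j) ->
  wp output (fun S' => [/\ written (arr S') (var S' vLen) link_family,
     arr S' aOut 0 = size link_family, clock S' <= z + size S * (4 * n + 11) + 10 &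
     var S' vLen <= 5 + size S * (n + 4)]) (Store z r a).
Proof.
move=> rS rT rC rK rD aN aS; wps; rewrite rK rD -size_link_family.
apply: wp_if => /=; rewrite rD => d0; wps.
  have st : s \in nb t by case: (s \in nb t) d0.
  set r1 := setv _ vJ 0; set a1 := seta _ _ _ _.
  have w1 : written a1 (r1 vLen) [:: (col, [:: s; t])].
    by split=> // -[|[|[|[|j]]]] //=; rewrite /a1 /= ?rC ?rS ?rT.
  apply: (wp_conseq (@write_traces_ok _ r1 a1 _ rS rT rC rK (erefl 0) aN aS w1)).
  move=> [z2 r2 a2] _ /= [w2 o2 c2 l2].
  by split; [rewrite /link_family st | | lia | move: l2; rewrite /r1 /=; lia].
have st : (s \in nb t) = false by case: (s \in nb t) d0.
set r1 := setv _ vJ 0; set a1 := seta _ _ _ _.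
apply: (wp_conseq (@write_traces_ok _ r1 a1 [::] rS rT rC rK (erefl 0) aN aS (written_nil _))).
move=> [z2 r2 a2] _ /= [w2 o2 c2 l2].
  by split; [rewrite /link_family st | | lia | move: l2; rewrite /r1 /=; lia].
Qed.

End Output.
End Color.

(** * The complete program *)

Definition push (k v : exp) :=
  vTop ::= EAdd vTop (ECst 1) ;; CPut aVal vTop v ;;
  CPut aLnk vTop (EGet aHd k) ;; CPut aHd k vTop.

Definition field k := EGet aIn (EAdd (EAdd vE vE) (EAdd vE (ECst k))).

(** The product is formed by adding [col] to itself [n] times, at cost [O(n)] however large the
    colour is; [aBase] then keeps it for [select]. *)
Definition times :=
  vBase ::= ECst 0 ;; vJ ::= ECst 0 ;;
  CWhile (ESub vN vJ) (vBase ::= EAdd vBase vCol ;; vJ ::= EAdd vJ (ECst 1)).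

Definition build :=
  vE ::= ECst 0 ;; vTop ::= ECst 0 ;;
  CWhile (ESub vM vE)
    (vA ::= field 0 ;; vB ::= field 1 ;; vCol ::= field 2 ;; times ;;
     CPut aBase vE vBase ;; push (EAdd vBase vA) vB ;; push (EAdd vBase vB) vA ;;
     vE ::= EAdd vE (ECst 1)).

Definition process :=
  CPut aDone vCol (ECst 1) ;; grow ;;
  CIf (ESub (EAdd vK vDir) vBest) (vBest ::= EAdd vK vDir ;; output) skip.

(** The loop runs over edges and skips colours marked in [aDone], because a loop over all colours
    would cost [c]. *)
Definition select :=
  vBest ::= ECst 0 ;; vLen ::= ECst 1 ;; vE ::= ECst 0 ;;
  CWhile (ESub vM vE)
    (vCol ::= field 2 ;; vBase ::= EGet aBase vE ;;
     CIf (EGet aDone vCol) skip process ;; vE ::= EAdd vE (ECst 1)).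

Definition solve := build ;; select.

Lemma times_ok z r a :
  wp times (fun S' => var S' vBase = r vCol * r vN /\ clock S' <= z + 3 * r vN + 3)
    (Store z r a).
Proof.
wps.
pose inv k (S' : store) := [/\ k + var S' vJ = r vN, var S' vBase = r vCol * var S' vJ &
  clock S' <= z + 2 + 3 * var S' vJ].
apply: (wp_while (I := inv) (k0 := r vN)).
- by split=> //=; rewrite ?addn0 ?muln0 //; lia.
- move=> k z' r' a' [fv _] [/= kE bE cl] /= g; wps.
  have rN : r' vN = r vN by apply: (fv 0 isT).
  have rC : r' vCol = r vCol by apply: (fv 8 isT).
  exists k.-1; first lia.
  by split=> /=; rewrite ?rC ?bE ?mulnDr ?muln1; lia.
- move=> k z' r' a' [fv _] [/= kE bE cl] /= g.
  have rN : r' vN = r vN by apply: (fv 0 isT).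
  have JE : r' vJ = r vN by lia.
  by rewrite bE JE; split=> //=; lia.
Qed.

Definition lists n (a : nat -> nat -> nat) top (f : nat -> nat -> seq nat) :=
  forall i u, u < n -> is_list (a aVal) (a aLnk) top (a aHd (i * n + u)) (f i u).

(** Uniqueness of Euclidean division by [n]: lists of different colours or vertices have different
    heads. *)
Lemma key_inj n i j u v : u < n -> v < n ->
  (i * n + u == j * n + v) = (i == j) && (u == v).
Proof.
move=> lu lv; apply/eqP/andP => [e | [/eqP -> /eqP ->] //].
have n0 : 0 < n by lia.
have := congr1 (divn^~ n) e; have := congr1 (modn^~ n) e.
by rewrite /= !modnMDl !divnMDl // !modn_small // !divn_small // !addn0 => -> ->.
Qed.

Lemma lists_push n hd val lnk top f i x y : x < n ->
  (forall j u, u < n -> is_list val lnk top (hd (j * n + u)) (f j u)) ->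
  forall j u, u < n ->
  is_list (setv val top.+1 y) (setv lnk top.+1 (hd (i * n + x))) top.+1
    (setv hd (i * n + x) top.+1 (j * n + u))
    (if (i == j) && (x == u) then y :: f j u else f j u).
Proof.
move=> lx h j u lu; rewrite [X in is_list _ _ _ X]setvE eq_sym key_inj //.
case: andP => [[/eqP <- /eqP <-] | _]; first by apply: is_list_cons; apply: h.
by apply: is_list_push; apply: h.
Qed.

Section Instance.
Variables (n c s t : nat) (E : seq cedge).
Hypothesis valid : valid_instance n c s t E.

Definition input_ok (a : nat -> nat -> nat) :=
  forall k, k < size E -> let e := nth (0, 0, 0) E k in
  [/\ a aIn (k + k + (k + 0)) = edge_u e, a aIn (k + k + (k + 1)) = edge_v e &
      a aIn (k + k + (k + 2)) = edge_col e].

Lemma input_mem_ok : input_ok (fun k i => if k == 0 then input_mem n c s t E (5 + i) else 0).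
Proof.
move=> k ltk e.
suff h d : d < 3 -> input_mem n c s t E (5 + (k + k + (k + d))) =
    match d with 0 => edge_u e | 1 => edge_v e | _ => edge_col e end.
  by split; rewrite /= h.
move=> ld; rewrite /input_mem; set y := 5 + _.
have -> : y == 0 = false by rewrite /y; lia.
have -> : y == 1 = false by rewrite /y; lia.
have -> : y == 2 = false by rewrite /y; lia.
have -> : y == 3 = false by rewrite /y; lia.
have -> : y == 4 = false by rewrite /y; lia.
have -> : (5 <= y) && (y < 5 + 3 * size E) by rewrite /y; lia.
have -> : (y - 5) %/ 3 = k by rewrite /y; lia.
by have -> : (y - 5) %% 3 = d by rewrite /y; lia.
Qed.

Lemma edge_bounds k : k < size E -> let e := nth (0, 0, 0) E k in
  [/\ edge_u e < n, edge_v e < n & edge_col e < c].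
Proof.
move=> ltk e; have /and5P[_ _ _ _ /andP[al _]] := valid.
by have /and4P[] := allP al e (mem_nth _ ltk).
Qed.

Lemma build_ok z r a :
  r vN = n -> r vM = size E -> input_ok a -> (forall i, a aHd i = 0) ->
  wp build (fun S' => [/\ lists n (arr S') (var S' vTop) (nbr E),
    forall k, k < size E -> arr S' aBase k = edge_col (nth (0, 0, 0) E k) * n &
    clock S' <= z + 3 + size E * (3 * n + 20)]) (Store z r a).
Proof.
move=> rN rM inp hd0; wps.
pose inv k (S' : store) := [/\ k + var S' vE = size E,
  lists n (arr S') (var S' vTop) (nbr (take (var S' vE) E)),
  forall k, k < var S' vE -> arr S' aBase k = edge_col (nth (0, 0, 0) E k) * n &
  clock S' <= z + 2 + var S' vE * (3 * n + 20)].
apply: (wp_while (I := inv) (k0 := size E)).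
- by split=> /=; [lia | move=> i u _ /=; rewrite take0 /= hd0 | | lia].
- move=> k z1 r1 a1 [fv fa] [/= kE ls bs cl] /= g.
  have rN1 : r1 vN = n by rewrite -rN; apply: (fv 0 isT).
  have rM1 : r1 vM = size E by rewrite -rM; apply: (fv 4 isT).
  have aI1 : a1 aIn = a aIn by apply: (fa 0 isT).
  have ltE : r1 vE < size E by lia.
  have [e0 e1 e2] := inp _ ltE; have [lu lv lc] := edge_bounds ltE.
  have := fun i u => @nbr_take E _ i u ltE.
  case ee: (nth _ _ _) e0 e1 e2 lu lv lc => [[x y] i].
  rewrite /edge_u /edge_v /edge_col /= => e0 e1 e2 lx ly lc tk.
  do 3![apply: wp_seq; apply: wp_set; rewrite /=].
  rewrite aI1 e0 e1 e2; apply: wp_seq.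
  apply: (wp_conseq (times_ok _ _ _)) => -[z2 r2 a2] [fv2 fa2] /= [b2 c2].
  rewrite rN1 in b2 c2.
  have rE2 : r2 vE = r1 vE by apply: (fv2 5 isT).
  have rA2 : r2 vA = x by apply: (fv2 24 isT).
  have rB2 : r2 vB = y by apply: (fv2 25 isT).
  have rT2 : r2 vTop = r1 vTop by apply: (fv2 9 isT).
  have aE2 k' : a2 k' = a1 k' by apply: (fa2 k' isT).
  wps; exists k.-1; first lia.
  split=> /=; rewrite ?rE2.
  + lia.
  + rewrite (addn1 (r1 vE)) /lists /= => j u lt; rewrite tk b2 rA2 rB2 rT2 !aE2 !addn1.
    have l1 := @lists_push n (a1 aHd) (a1 aVal) (a1 aLnk) _ _ i x y lx ls.
    exact: (@lists_push n _ _ _ _ (fun j u => if (i == j) && (x == u)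
      then y :: nbr (take (r1 vE) E) j u else nbr (take (r1 vE) E) j u) i y x ly l1 j u lt).
  + move=> k' ; rewrite setvE; case: eqP => [-> _ | ne lt]; first by rewrite ee b2.
    by rewrite aE2; apply: bs; lia.
  + by rewrite (addn1 (r1 vE)) mulSn; lia.
- move=> k z1 r1 a1 [fv fa] [/= kE ls bs cl] /= g.
  have rM1 : r1 vM = size E by rewrite -rM; apply: (fv 4 isT).
  have eE : r1 vE = size E by lia.
  rewrite eE ?take_size in ls bs cl; split=> //=.
  lia.
Qed.

Lemma valid_ends : [/\ s != t, s < n & t < n].
Proof. by have /and5P[_ ? ? ? _] := valid. Qed.

Lemma nbr_lt i u v : v \in nbr E i u -> v < n.
Proof.
have /and5P[_ _ _ _ /andP[al _]] := valid; rewrite -adj_nbr => /orP[] /(allP al) /and4P[] //.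
Qed.

Definition edges_of col := count (fun e => edge_col e == col) E.

Definition best_for col b :=
  forall G, cdp_family c E s t G -> all (fun p => p.1 == col) G -> size G <= b.

Definition holds (r : nat -> nat) (a : nat -> nat -> nat) F :=
  [/\ cdp_family c E s t F, written a (r vLen) F, a aOut 0 = size F & r vBest = size F].

Lemma process_ok top z r a F col :
  context n s t (nbr E col) (col * n) top r a -> r vCol = col -> col < c ->
  holds r a F ->
  wp process (fun S' => exists F', [/\ holds (var S') (arr S') F', size F <= size F',
    best_for col (size F'), arr S' aDone = setv (a aDone) col 1 &
    clock S' <= z + 100 * ((2 * edges_of col).+1 * n.+1) /\
    var S' vLen <= maxn (r vLen) (5 + 2 * edges_of col * (n + 4))])
    (Store z r a).
Proof.
move=> ctx rC ltc [fF wF o0 rB]; have [st sn tn] := valid_ends.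
have deg : forall Q, uniq Q -> \sum_(u <- Q) size (nbr E col u) <= 2 * edges_of col.
  by move=> Q; apply: sum_nbr.
apply: wp_seq; apply: wp_put; rewrite /= rC; apply: wp_seq.
apply: (wp_conseq (@grow_ok n s t (nbr E col) (col * n) top st sn tn (@nbr_lt col)
  (@nbr_sym E col) _ deg z.+1 r (seta a aDone col 1) ctx)).
move=> [z1 r1 a1] fr1 /= [[L1 d1 max1] c1].
have [fv1 fa1] := fr1.
have ctx1 : context n s t (nbr E col) (col * n) top r1 a1.
  exact: (context_frame fr1 ctx isT isT).
have rC1 : r1 vCol = col by rewrite -rC; apply: (fv1 8 isT).
have rB1 : r1 vBest = size F by rewrite -rB; apply: (fv1 21 isT).
have rL1 : r1 vLen = r vLen by apply: (fv1 22 isT).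
have aD1 : a1 aDone = setv (a aDone) col 1 by apply: (fa1 11 isT).
have aO1 : a1 aOut = a aOut by apply: (fa1 1 isT).
have best1 : best_for col (r1 vK + r1 vDir).
  by move=> G fG aG; apply: max1 fG aG => u v; apply: adj_nbr.
have Kn : r1 vK <= n by have := linking_size L1; rewrite size_mkseq.
have Kd : r1 vK <= 2 * edges_of col.
  have := linking_size_nb (@nbr_sym E col) L1; rewrite size_mkseq => le.
  by apply: leq_trans le _; have := deg [:: s] isT; rewrite big_seq1.
(* With [K] paths and [d] twice the number of edges, [K * n] is bounded through [K <= d] and [K * d]
   through [K <= n]. *)
have bound : 3 * n + 8 + (r1 vK).+1 * (26 * n + 11 * (2 * edges_of col) + 20) +
    r1 vK * (4 * n + 11) + 20 <= 100 * ((2 * edges_of col).+1 * n.+1).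
  move: (2 * edges_of col) (r1 vK) Kn Kd => d K; nia.
apply: wp_if => /= imp; last first.
  wps; exists F; split=> //=.
  - by rewrite /holds /written /= aO1 rL1 rB1; split.
  - by move=> G fG aG; have := best1 G fG aG; lia.
  - by rewrite rL1 leq_maxl; split=> //; lia.
apply: wp_seq; apply: wp_set; rewrite /=.
have [rN1 rS1 rT1 _ _] := ctx1.
set S := mkseq (a1 aStart) (r1 vK) in L1 *.
have szS : size S = r1 vK by rewrite size_mkseq.
have aS1 j : j < size S -> a1 aStart j = nth 0 S j.
  by rewrite szS => lj; rewrite nth_mkseq.
apply: (wp_conseq (@output_ok n s t (nbr E col) st sn tn (a1 aNext) S col L1 _
  (setv r1 vBest (r1 vK + r1 vDir)) a1 rS1 rT1 rC1 (esym szS) d1 (erefl _) aS1)).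
move=> [z2 r2 a2] [fv2 fa2] /= [w2 o2 c2 l2].
have szF := @size_link_family n s t (nbr E col) (a1 aNext) S col.
have rB2 : r2 vBest = r1 vK + r1 vDir by apply: (fv2 21 isT).
have szE : size (link_family n s t (nbr E col) (a1 aNext) S col) = r1 vK + r1 vDir.
  by rewrite szF szS d1.
exists (link_family n s t (nbr E col) (a1 aNext) S col); split.
- split=> //; last by rewrite rB2 szE.
  by apply: (trace_family st sn tn (@nbr_sym E col) L1 ltc) => u v; apply: adj_nbr.
- by rewrite szE; lia.
- by rewrite szE.
- by rewrite -aD1; apply: (fa2 11 isT).
- rewrite szS in c2 l2; split; first lia.
  rewrite leq_max; apply/orP; right; apply: leq_trans l2 _.
  by rewrite leq_add2l leq_mul2r Kd orbT.
Qed.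

Lemma select_ok top z r a :
  r vN = n -> r vS = s -> r vT = t -> r vM = size E -> input_ok a ->
  lists n a top (nbr E) ->
  (forall k, k < size E -> a aBase k = edge_col (nth (0, 0, 0) E k) * n) ->
  (forall i, a aDone i = 0) -> a aOut 0 = 0 ->
  wp select (fun S' => exists F, [/\ holds (var S') (arr S') F,
    forall e, e \in E -> best_for (edge_col e) (size F),
    clock S' <= z + 4 + 8 * size E + 300 * (size E * n.+1) &
    var S' vLen <= 5 + 2 * size E * (n + 4)]) (Store z r a).
Proof.
move=> rN rS rT rM inp ls bs dn o0; wps.
pose cols k := [seq edge_col e | e <- take k E].
(* This counts, in the whole of [E], the edges of the colours met so far: the cost of processing a
   colour is charged to all its edges at once. *)
pose todo k := count (fun e => edge_col e \in cols k) E.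
pose inv k (S' : store) := exists F, [/\ k + var S' vE = size E,
  holds (var S') (arr S') F,
  forall i, i \in cols (var S' vE) -> best_for i (size F),
  forall i, (arr S' aDone i != 0) = (i \in cols (var S' vE)) &
  clock S' <= z + 3 + 8 * var S' vE + 300 * (todo (var S' vE) * n.+1) /\
  var S' vLen <= 5 + 2 * size E * (n + 4)].
apply: (wp_while (I := inv) (k0 := size E)).
- exists [::]; split=> /=; [lia | by split | | | split; lia].
    by move=> i; rewrite /cols take0.
  by move=> i; rewrite /cols take0 dn.
- move=> k z1 r1 a1 fr [F [/= kE hF best dn1 [cl le]]] /= g.
  have [fv fa] := fr.
  have rN1 : r1 vN = n by rewrite -rN; apply: (fv 0 isT).
  have rS1 : r1 vS = s by rewrite -rS; apply: (fv 2 isT).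
  have rT1 : r1 vT = t by rewrite -rT; apply: (fv 3 isT).
  have rM1 : r1 vM = size E by rewrite -rM; apply: (fv 4 isT).
  have aI1 : a1 aIn = a aIn by apply: (fa 0 isT).
  have aB1 : a1 aBase = a aBase by apply: (fa 12 isT).
  have aH1 : a1 aHd = a aHd by apply: (fa 2 isT).
  have aV1 : a1 aVal = a aVal by apply: (fa 3 isT).
  have aL1 : a1 aLnk = a aLnk by apply: (fa 4 isT).
  have ltE : r1 vE < size E by lia.
  have [_ _ e2] := inp _ ltE; have [_ _ lc] := edge_bounds ltE.
  set col := edge_col _ in e2 lc.
  have colsS : cols (r1 vE).+1 = rcons (cols (r1 vE)) col.
    by rewrite /cols (take_nth (0, 0, 0)) // map_rcons.
  do 2![apply: wp_seq; apply: wp_set; rewrite /=]; apply: wp_seq.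
  rewrite aI1 e2 aB1 bs // -/col.
  apply: wp_if => /= dc.
    wps; exists k.-1; first lia.
    have cin : col \in cols (r1 vE) by rewrite -dn1; apply/eqP.
    have same i : (i \in cols (r1 vE).+1) = (i \in cols (r1 vE)).
      by rewrite colsS mem_rcons inE; case: eqP => // ->.
    exists F; split=> //=; rewrite ?(addn1 (r1 vE)).
    + lia.
    + by move=> i; rewrite same; apply: best.
    + by move=> i; rewrite same.
    + split=> //; have -> : todo (r1 vE).+1 = todo (r1 vE); last lia.
      by apply: eq_count => e; rewrite same.
  set r2 := setv _ vBase _.
  have ctx2 : context n s t (nbr E col) (col * n) top r2 a1.
    by split=> // u lu; rewrite aV1 aL1 aH1; apply: ls.
  apply: (wp_conseq (process_ok _ ctx2 (erefl col) lc (F := F) _)) => //.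
  move=> [z3 r3 a3] [fv3 fa3] /= [F' [hF' leF bF' aD3 [c3 l3]]]; wps.
  have rE3 : r3 vE = r1 vE by apply: (fv3 5 isT).
  have cnin : col \notin cols (r1 vE) by rewrite -dn1 dc.
  exists k.-1; first lia.
  (* Having at least one edge gives [2 * d + 1 <= 3 * d], which turns the factor 100 into 300. *)
  have gt0 : 0 < edges_of col.
    by rewrite -has_count; apply/hasP; exists (nth (0, 0, 0) E (r1 vE)); rewrite ?mem_nth ?eqxx.
  have todoS : todo (r1 vE).+1 = todo (r1 vE) + edges_of col.
    rewrite /todo /edges_of -count_predUI.
    rewrite [X in _ = _ + X](_ : _ = 0) ?addn0.
      by apply: eq_count => e /=; rewrite colsS mem_rcons inE orbC.
    apply/eqP; rewrite eqn0Ngt -has_count; apply/hasP => -[e _ /andP[/= e1 /eqP e3]].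
    by rewrite e3 (negPf cnin) in e1.
  exists F'; split=> //=; rewrite ?rE3 ?(addn1 (r1 vE)).
  + lia.
  + move=> i; rewrite colsS mem_rcons inE => /orP[/eqP -> //|/best bi].
    by move=> G fG aG; apply: leq_trans (bi G fG aG) leF.
  + move=> i; rewrite aD3 colsS mem_rcons inE setvE -dn1.
    by case: (i == col).
  + split.
      rewrite todoS; move: c3 cl; move: (edges_of col) (todo _) gt0 => d w; nia.
    apply: leq_trans l3 _; rewrite geq_max le leq_add2l leq_mul2r leq_mul2l.
    by rewrite count_size !orbT.
- move=> k z1 r1 a1 fr [F [/= kE hF best dn1 [cl le]]] /= g.
  have [fv _] := fr; have rM1 : r1 vM = size E by rewrite -rM; apply: (fv 4 isT).
  have eE : r1 vE = size E by lia.
  exists F; split=> //=.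
  + move=> e eE'; apply: best; rewrite eE /cols take_size; exact: map_f.
  + have : todo (r1 vE) <= size E by apply: count_size.
    rewrite eE in cl *; move: (todo _) cl => w; nia.
Qed.

Lemma solve_ok z r a :
  r vN = n -> r vS = s -> r vT = t -> r vM = size E -> input_ok a ->
  (forall k i, 0 < k -> a k i = 0) ->
  wp solve (fun S' => exists F, [/\ holds (var S') (arr S') F,
    forall e, e \in E -> best_for (edge_col e) (size F),
    clock S' <= z + 400 * ((size E).+1 * n.+1) &
    var S' vLen <= 5 + 2 * size E * (n + 4)]) (Store z r a).
Proof.
move=> rN rS rT rM inp a0; apply: wp_seq.
apply: (wp_conseq (@build_ok z r a rN rM inp (fun i => a0 2 i isT))).
move=> [z1 r1 a1] [fv fa] /= [ls bs c1].
have rN1 : r1 vN = n by rewrite -rN; apply: (fv 0 isT).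
have rS1 : r1 vS = s by rewrite -rS; apply: (fv 2 isT).
have rT1 : r1 vT = t by rewrite -rT; apply: (fv 3 isT).
have rM1 : r1 vM = size E by rewrite -rM; apply: (fv 4 isT).
have inp1 : input_ok a1 by rewrite /input_ok (_ : a1 0 = a 0) //; apply: (fa 0 isT).
have dn1 i : a1 aDone i = 0 by rewrite (_ : a1 11 = a 11) ?a0 //; apply: (fa 11 isT).
have o1 : a1 aOut 0 = 0 by rewrite (_ : a1 1 = a 1) ?a0 //; apply: (fa 1 isT).
apply: (wp_conseq (select_ok z1 rN1 rS1 rT1 rM1 inp1 ls bs dn1 o1)).
move=> [z2 r2 a2] _ /= [F [hF bF c2 l2]]; exists F; split=> //.
by move: (size E) c1 c2 => m; nia.
Qed.

Lemma family_color_bound F b : all (fun p : cpath => p.1 < c) F ->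
  (forall i, i < c -> count (fun p : cpath => p.1 == i) F <= b) -> size F <= c * b.
Proof.
elim: c F => [|c' IH] F aF cF.
  by case: F aF {cF} => [|p F] //=.
rewrite -(count_predC (fun p : cpath => p.1 == c') F) mulSn leq_add ?cF //.
rewrite -size_filter; apply: IH => [|i lti].
  apply/allP => p; rewrite mem_filter => /andP[/= ne pF].
  by have := allP aF p pF; rewrite ltnS leq_eqVlt (negPf ne).
rewrite count_filter; apply: leq_trans (cF i (leqW lti)).
by apply: sub_count => p /= /andP[].
Qed.

(** A colour without edges carries no path because [s] and [t] differ, so a bound for the colours
    that occur is a bound for all [c] of them. *)
Lemma family_optimal b G : cdp_family c E s t G ->
  (forall e, e \in E -> best_for (edge_col e) b) -> size G <= c * b.
Proof.
move=> fG best; have /and3P[uG aG pG] := fG; have [st _ _] := valid_ends.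
apply: family_color_bound => [|i lti].
  by apply/allP => p /(allP aG) /andP[].
rewrite -size_filter; set H := filter _ G.
have aH : all (fun p => p.1 == i) H by apply: filter_all.
have fH : cdp_family c E s t H.
  rewrite /cdp_family filter_uniq // pairwise_filter // andbT.
  by apply/allP => p; rewrite mem_filter => /andP[_ /(allP aG)].
case eH: H => [//|p H']; rewrite -eH.
suff [e eE eC] : exists2 e, e \in E & edge_col e = i.
  by apply: (best e eE) => //; rewrite eC.
have pH : p \in H by rewrite eH mem_head.
have /and3P[_ /allP/(_ p pH)/andP[_ up] _] := fH.
move: up; have /eqP -> := allP aH p pH.
case: p.2 => // x [|y q] /=.
  by case/and3P=> /eqP -> e; rewrite (negPf st) in e.
case/and4P=> _ /andP[/orP[] xy _] _ _; [by exists (x, y, i) | by exists (y, x, i)].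
Qed.

End Instance.

(** * Assembling the machine program *)

Definition step_cost := 60.
Definition solve_code := compile solve boot_size.
Definition emit_code := emit vLen (boot_size + size solve_code).
Definition cdp_program : program := boot ++ solve_code ++ emit_code.

Lemma code_at_parts p1 p2 p3 (P := p1 ++ p2 ++ p3) :
  [/\ code_at P 0 p1, code_at P (size p1) p2 & code_at P (size p1 + size p2) p3].
Proof.
split; [exact: (code_at_mid [::]) | exact: code_at_mid |].
by have := code_at_mid (p1 ++ p2) p3 [::]; rewrite cats0 -catA size_cat.
Qed.

Lemma okcmd_solve : okcmd step_cost solve.
Proof. by vm_compute. Qed.

(* There is a RAM program running in O(mn) steps that, on every c-colors
   graph with nodes s,t, halts with a feasible CDP family whose size is at
   least 1/c of the size of any feasible family (i.e. of the maximum). *)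
Theorem theorem2 :
  exists (P : program) (K : nat),
    forall (n c s t : nat) (E : seq cedge),
      valid_instance n c s t E ->
      exists N : nat,
        N <= K * ((size E).+1 * n.+1) /\
        halted P (exec P N (init_state n c s t E)) /\
        let out := decode_output (exec P N (init_state n c s t E)).2 in
        cdp_family c E s t out /\
        (forall F : seq cpath, cdp_family c E s t F -> size F <= c * size out).
Proof.
(* 400 is the tick bound of [solve_ok]; the remaining 500 covers loading the input and packing an
   output of length [O(mn)]. *)
exists cdp_program, (step_cost * 400 + 500) => n c s t E valid.
have [st sn tn] := valid_ends valid.
have [cb cs ce] := code_at_parts boot solve_code emit_code.
rewrite -/cdp_program size_boot in cb cs ce.
have n1 : 1 < n by lia.
set M0 := input_mem n c s t E.
have [|||M1 [N1 [run1 b1 rep1 low1]]] := @boot_ok cdp_program M0 n (size E) cb n1 => //.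
  move=> y ly; rewrite /M0 /input_mem.
  by do ![case: eqP => [?|_]; first lia]; rewrite [y < _]ltnNge ly andbF.
set a0 := (fun k i => _) in rep1.
have [||||||S' runS [F [[fF wF oF bF] best cl le]]] :=
  @solve_ok n c s t E valid 0 M1 a0; try by rewrite low1.
- exact: input_mem_ok.
- by move=> [|k] i.
have leB : nregs <= 64 * n + 3 * size E by have -> : nregs = 40 by []; lia.
have [M2 [N2 [run2 rep2 b2]]] := compile_ok leB runS okcmd_solve rep1 cs.
have [||M3 [N3 [h3 e3 b3 M30 out3]]] := emit_ok ce leB rep2 => //.
have ex : exec cdp_program (N1 + N2 + N3) (init_state n c s t E) =
    exec cdp_program N3 (boot_size + size solve_code, M2).
  by rewrite !exec_add run1 run2.
exists (N1 + N2 + N3); split; last first.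
  rewrite ex e3; split=> //.
  have len0 : 0 < var S' vLen by case: wF => ->.
  have -> : decode_output M3 = F.
    rewrite /decode_output M30 -{2}[64 * n + _]addn0 out3 // oF.
    apply: decode_encode => j lj; case: wF => lE wF.
    by rewrite -wF // addSnnS out3 // lE.
  by split=> // G fG; apply: (family_optimal valid fG best).
rewrite muln0 addn0 in b2.
have : N2 <= step_cost * 400 * ((size E).+1 * n.+1).
  by apply: leq_trans b2 _; rewrite -mulnA leq_mul2l; apply/orP; right.
move: (step_cost * 400) (size E) b1 b3 le => L m b1 b3 le b2'.
rewrite mulnDl; nia.
Qed.
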